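(* There exists a constant $C$ such that every graph $G=(V,E)$ with maximum degree $\Delta\geq 2$ and minimum degree $\delta\geq C\log\Delta$ admits a vertex-colouring $3$-weighting, i.e. there exists a mapping $\omega:E\to\{1,2,3\}$ such that for every edge $uv\in E$, $$\sum_{e\in E(u)}\omega(e)\neq\sum_{e\in E(v)}\omega(e),$$ where $E(x)$ denotes the set of edges of $G$ incident with the vertex $x$.
   Context: Graphs are finite, simple and undirected. Here $\log$ denotes the natural logarithm. The constant $C$ is universal (it does not depend on the graph). A $k$-weighting of a graph $G=(V,E)$ is a mapping $\omega:E\to\{1,2,\ldots,k\}$. For $v\in V$, let $E(v)$ be the set of edges incident with $v$ and let $s_\omega(v):=\sum_{e\in E(v)}\omega(e)$ be the weighted degree (sum) of $v$. The weighting $\omega$ is called vertex-colouring if $s_\omega(u)\neq s_\omega(v)$ for every edge $uv\in E$. *)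

(* Defs.v *)
From mathcomp Require Import all_boot.

Set Implicit Arguments.
Unset Strict Implicit.
Unset Printing Implicit Defensive.

Record sgraph := SGraph {
  vertex :> finType;
  adj : rel vertex;
  adj_sym : symmetric adj;
  adj_irrefl : irreflexive adj
}.

Section Graph.
Variable G : sgraph.

(* An edge uv is the unordered pair [set u; v]. *)
Definition edges : {set {set G}} :=
  [set [set p.1; p.2] | p : G * G & adj p.1 p.2].

Definition incident (v : G) : {set {set G}} := [set e in edges | v \in e].

Definition degree (v : G) : nat := #|incident v|.

Definition max_degree : nat := \max_(v : G) degree v.

(* The default #|G| exceeds every degree, so on a nonempty graph this is the
   minimum of the degrees. *)
Definition min_degree : nat := \big[minn/#|G|]_(v : G) degree v.

(* A k-weighting is represented by a function on all vertex sets, of which only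
   the values on edges are constrained or ever used. *)
Definition weighting (k : nat) (w : {set G} -> nat) : Prop :=
  forall e, e \in edges -> 1 <= w e <= k.

Definition weighted_degree (w : {set G} -> nat) (v : G) : nat :=
  \sum_(e in incident v) w e.

Definition vertex_colouring (w : {set G} -> nat) : Prop :=
  forall u v : G, adj u v -> weighted_degree w u <> weighted_degree w v.

End Graph.

(* Main.v *)
Require Import Defs.
From mathcomp Require Import all_boot all_order all_algebra.
From mathcomp Require Import reals sequences exp.
From mathcomp Require Import ring lra zify.

Set Implicit Arguments.
Unset Strict Implicit.
Unset Printing Implicit Defensive.

Import Order.TTheory GRing.Theory Num.Theory.
Local Open Scope ring_scope.

(** Every vertex v receives an independent uniform label: a position x_v in
    {0, ..., K-1}, a class y_v in {0, ..., q-1}, and a third coordinate that puts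
    v into a sparse random set W with probability 1/q.  An edge between W and its
    complement whose ends have the same class is called tunable, an edge inside W
    is called inner; both kinds start with weight 2.  Every other edge uv starts
    with weight 3 if x_u + x_v >= K and with weight 1 otherwise.  The sum at v is
    then close to d(v)(1 + 2 x_v / K), so that the sum of a random vertex u is
    spread evenly, with density 1 / (2 d(u)), over the range from d(u) to 3 d(u).

    All that is needed of the labels is that finitely many counts in each
    neighbourhood are within eps d(v) of their means.  By Chernoff's bound
    ([chernoff]) one count fails with probability at most exp(- eps^2 d(v) / 8), which the
    hypothesis on the minimum degree makes smaller than any fixed power of
    1 / Delta.  A failure at v depends only on the labels around v, so the Lovasz
    local lemma ([local_lemma]) gives labels without any failure
    ([typical_labelling], [typical_labels]).

    Outside W.  The integers are cut into cells whose length is a small fraction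
    of the values in them.  A vertex v outside W moves its sum to a value in the
    cell of its starting sum, so only neighbours that start in the same cell
    compete with it.  Treat the vertices by decreasing degree: a neighbour u
    treated before v has d(u) >= d(v), hence density at most 1 / (2 d(v)), and
    all these neighbours together take little more than half of the cell.  The
    values congruent to 0, 1, 2, 3 modulo 6 make up two thirds of the cell, so a
    free one exists ([greedy_choice]).  It is reached by changing tunable edges
    at v by one unit each; such an edge has only one end outside W, so the
    choices do not interfere.

    Inside W.  The sums must become 4 or 5 modulo 6, which separates them from
    the sums outside W.  Treat the vertices of W one after the other; each one
    reserves a pair {6k+4, 6k+5} and stays in it.  An inner edge is changed once,
    by the end that owns it: an earlier end may raise it freely, and a later end
    changes it by the sign that keeps the other end in its pair.  So a vertex
    that owns N edges chooses among about N/6 pairs ([pair_stage]).  It owns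
    about d/(2q) edges, while only O(d/q^2) of its neighbours in W have a sum near
    its own, because W and the positions are independent; the choice q = 1024
    makes the first number win.  The two stages are combined in [assembly]. *)

(** * The Lovasz local lemma *)

Section LocalLemma.
Variables (R : realFieldType) (Om V : finType) (A : V -> {set Om}).
Variables (dep : rel V) (p : R) (D : nat).

Definition avoiding (S : {set V}) : {set Om} :=
  [set w | [forall v in S, w \notin A v]].

Lemma avoidingU1 v S : avoiding (v |: S) = avoiding S :\: A v.
Proof.
apply/setP => w; rewrite !inE; apply/forall_inP/andP => [H|[wA /forall_inP H] u].
  split; first by apply: H; rewrite setU11.
  by apply/forall_inP => u uS; apply: H; rewrite setU1r.
by rewrite !inE => /orP [/eqP->|/H].
Qed.

Lemma avoidingS (S S' : {set V}) : S \subset S' -> avoiding S' \subset avoiding S.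
Proof.
move=> /subsetP sS; apply/subsetP => w; rewrite !inE => /forall_inP H.
by apply/forall_inP => v /sS /H.
Qed.

Hypothesis Om_gt0 : (0 < #|Om|)%N.
Hypothesis leAp : forall v, #|A v|%:R <= p * #|Om|%:R.
Hypothesis le_dep : forall v, (#|[set u | dep v u]| <= D)%N.
(** Independence of [A v] from every combination of events not related to [v],
    by counting, so that no division occurs. *)
Hypothesis indep : forall v (S : {set V}), (forall u, u \in S -> ~~ dep v u) ->
  (#|A v :&: avoiding S| * #|Om| = #|A v| * #|avoiding S|)%N.
Hypothesis D_gt0 : (0 < D)%N.
Hypothesis pD : 4 * p * D%:R <= 1.

(** The usual induction: conditioned on avoiding the events in [S], the event
    [A v] has probability at most [2 * p].  The events of [S] that do not depend
    on [v] are removed by independence; by induction the at most [D] others cost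
    at most half of the remaining outcomes, whence the factor 2. *)
Lemma local_lemma_step n (S : {set V}) v : (#|S| < n)%N ->
  #|A v :&: avoiding S|%:R <= 2 * p * #|avoiding S|%:R.
Proof.
elim: n S v => // n IHn S v; rewrite ltnS => leSn.
have p_ge0 : 0 <= p.
  have := leAp v; have : (0 : R) < #|Om|%:R by rewrite ltr0n.
  move=> o0 h; rewrite -(pmulr_lge0 _ o0); exact: le_trans (ler0n _ _) h.
pose S1 := [set u in S | dep v u]; pose S2 := S :\: S1.
have sS2 : S2 \subset S by apply: subsetDl.
have h1 : #|A v :&: avoiding S|%:R <= p * #|avoiding S2|%:R.
  have : (#|A v :&: avoiding S|%:R : R) <= #|A v :&: avoiding S2|%:R.
    by rewrite ler_nat; apply/subset_leq_card/setIS/avoidingS.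
  move/le_trans; apply.
  have o0 : (0 : R) < #|Om|%:R by rewrite ltr0n.
  rewrite -(ler_pM2r o0) -natrM indep; last first.
    by move=> u; rewrite !inE => /andP [h uS]; move: h; rewrite uS.
  rewrite natrM mulrAC; apply: ler_wpM2r => //; exact: leAp.
case: (set_0Vmem S1) => [S10|[u0 u0S1]].
  have S2E : S2 = S by rewrite /S2 S10 setD0.
  rewrite S2E in h1; apply: le_trans h1 _.
  have : 0 <= p * #|avoiding S|%:R by rewrite mulr_ge0.
  lra.
have ltS2 : (#|S2| < n)%N.
  apply: leq_trans leSn; apply: proper_card; rewrite properE sS2 /=.
  apply/subsetPn; exists u0; first by move: u0S1; rewrite inE => /andP [].
  by rewrite inE u0S1.
have S1D : (#|S1| <= D)%N.
  apply: leq_trans (le_dep v); apply: subset_leq_card.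
  by apply/subsetP => u; rewrite !inE => /andP [].
have split_card : (#|avoiding S2| <= #|avoiding S| + \sum_(u in S1) #|A u :&: avoiding S2|)%N.
  have sub : avoiding S2 \subset avoiding S :|: \bigcup_(u in S1) (A u :&: avoiding S2).
    apply/subsetP => w wS2; rewrite inE; case: (boolP (w \in avoiding S)) => //= nw.
    move: nw; rewrite inE negb_forall_in => /exists_inP [u uS]; rewrite negbK => wu.
    apply/bigcupP; exists u; last by rewrite inE wu.
    move: wS2; rewrite inE => /forall_inP wS2; apply/negPn/negP => nu.
    by move: (wS2 u); rewrite inE nu uS wu => /(_ isT).
  apply: leq_trans (subset_leq_card sub) _; apply: leq_trans (leq_card_setU _ _) _; rewrite leq_add2l.
  apply: (big_rec2 (fun (x : {set Om}) m => #|x| <= m)%N); first by rewrite cards0.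
  move=> u y1 y2 _ h; apply: (leq_trans (leq_card_setU _ _)).
  by rewrite leq_add2l.
have sumle : \sum_(u in S1) #|A u :&: avoiding S2|%:R <= D%:R * (2 * p * #|avoiding S2|%:R).
  apply: (le_trans (y := \sum_(u in S1) 2 * p * #|avoiding S2|%:R)).
    by apply: ler_sum => u _; apply: IHn.
  rewrite sumr_const -[leLHS]mulr_natl; apply: ler_wpM2r; last by rewrite ler_nat.
  by rewrite !mulr_ge0.
move: split_card; rewrite -(ler_nat R) natrD natr_sum => split_card.
have c0 : (0 : R) <= #|avoiding S2|%:R by [].
have half : #|avoiding S2|%:R <= 2 * #|avoiding S|%:R :> R.
  have : D%:R * (2 * p * #|avoiding S2|%:R) <= 2^-1 * #|avoiding S2|%:R.
    rewrite (_ : _ * _ = (2 * p * D%:R) * #|avoiding S2|%:R); last by ring.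
    apply: ler_wpM2r => //; move: pD; set x := p * D%:R; rewrite -!mulrA -/x; lra.
  lra.
apply: le_trans h1 _; rewrite (mulrC 2 p) -mulrA; exact: ler_wpM2l.
Qed.

Lemma local_lemma : exists w, forall v, w \notin A v.
Proof.
suff : (0 < #|avoiding setT|)%N.
  case/card_gt0P => w; rewrite inE => /forall_inP H.
  by exists w => v; apply: H; rewrite inE.
have pos n (S : {set V}) : #|S| = n -> (0 < #|avoiding S|)%N.
  elim: n S => [|n IHn] S.
    move/eqP; rewrite cards_eq0 => /eqP ->.
    suff -> : avoiding set0 = setT by rewrite cardsT.
    by apply/setP => w; rewrite !inE; apply/forall_inP => v; rewrite inE.
  move=> cS; have /card_gt0P [v vS] : (0 < #|S|)%N by rewrite cS.
  rewrite -(setD1K vS) avoidingU1.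
  have cS' : #|S :\ v| = n by have := cardsD1 v S; rewrite vS cS => -[].
  have := IHn _ cS'; set S' := S :\ v => S'0.
  have h := @local_lemma_step n.+1 S' v; rewrite cS' in h.
  have := h (leqnn _); rewrite setIC => {}h.
  have := cardsID (A v) (avoiding S'); rewrite addnC => cE.
  have : (#|avoiding S'|%:R : R) = #|avoiding S' :\: A v|%:R + #|avoiding S' :&: A v|%:R.
    by rewrite -natrD cE.
  have S'0R : (0 : R) < #|avoiding S'|%:R by rewrite ltr0n.
  move=> eqR; rewrite -(ltr0n R).
  have p4 : 4 * p <= 1.
    case: (lerP 0 p) => p0; last by lra.
    apply: le_trans pD; rewrite ler_peMr //; first by lra.
    by rewrite ler1n.
  have : 2 * p * #|avoiding S'|%:R <= 2^-1 * #|avoiding S'|%:R.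
    by apply: ler_wpM2r; lra.
  lra.
exact: pos.
Qed.

End LocalLemma.

(** * Product spaces and Chernoff's bound *)

Section ProductSpace.
Variables (V L : finType).

Definition splice (N : {set V}) (f g : {ffun V -> L}) : {ffun V -> L} :=
  [ffun v => if v \in N then f v else g v].

(** Exchanging the coordinates in [N] between two points of the product is an
    involution that turns pairs (point of [P] and [Q], any point) into pairs
    (point of [P], point of [Q]). *)
Lemma disjoint_support_indep (N : {set V}) (P Q : {set {ffun V -> L}}) :
  (forall f g : {ffun V -> L}, {in N, f =1 g} -> (f \in P) = (g \in P)) ->
  (forall f g : {ffun V -> L}, {in ~: N, f =1 g} -> (f \in Q) = (g \in Q)) ->
  (#|P :&: Q| * #|[set: {ffun V -> L}]| = #|P| * #|Q|)%N.
Proof.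
move=> hP hQ.
pose swap (fg : {ffun V -> L} * {ffun V -> L}) :=
  (splice N fg.1 fg.2, splice N fg.2 fg.1).
have swapK : involutive swap.
  case=> f g; rewrite /swap /=.
  by congr pair; apply/ffunP => v; rewrite !ffunE; case: (v \in N).
rewrite -!cardsX -(card_imset _ (inv_inj swapK)).
apply: eq_card => -[f g]; rewrite (can_imset_pre _ swapK) !inE andbT /=.
congr (_ && _).
  by apply: hP => v vN; rewrite ffunE vN.
by apply: hQ => v; rewrite inE ffunE => /negbTE ->.
Qed.

End ProductSpace.

Section Chernoff.
Variables (R : realType) (V L : finType).
Hypothesis L_gt0 : (0 < #|L|)%N.

Definition prob (B : {set L}) : R := #|B|%:R / #|L|%:R.

Lemma prob_ge0 B : 0 <= prob B.
Proof. by rewrite divr_ge0. Qed.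

Lemma prob_le1 B : prob B <= 1.
Proof. by rewrite ler_pdivrMr ?ltr0n // mul1r ler_nat max_card. Qed.

Lemma probC B : prob (~: B) = 1 - prob B.
Proof.
apply/eqP; rewrite eq_sym subr_eq -mulrDl -natrD addnC cardsC divff //.
by rewrite pnatr_eq0 -lt0n.
Qed.

Definition hits (N : {set V}) (B : V -> {set L}) (f : {ffun V -> L}) : nat :=
  #|[set u in N | f u \in B u]|.

(** From exp (-t) >= 1 - t by inversion. *)
Lemma expR_quadratic (t : R) : 0 <= t <= 4^-1 -> expR t <= 1 + t + 2 * t ^+ 2.
Proof.
move=> /andP [t0 t1].
have h : 1 - t <= expR (- t) := expR_ge1Dx _.
have t1' : 0 < 1 - t by lra.
have : expR t <= (1 - t)^-1.
  by rewrite -[t]opprK expRN opprK lef_pV2 ?posrE ?expR_gt0.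
move/le_trans; apply; rewrite -div1r ler_pdivrMr //.
have : 0 <= t * t by rewrite mulr_ge0.
have : 0 <= t * t * (4^-1 - t) by rewrite !mulr_ge0 // subr_ge0.
rewrite expr2; nra.
Qed.

(** The sum over all labellings of a product over the vertices is the product of
    the sums over the labels. *)
Lemma exp_moment (N : {set V}) (B : V -> {set L}) (t : R) :
  \sum_(f : {ffun V -> L}) expR (t * (hits N B f)%:R) =
  #|{: {ffun V -> L}}|%:R * \prod_(u in N) (1 + (expR t - 1) * prob (B u)).
Proof.
pose F u a := if (u \in N) && (a \in B u) then expR t else 1.
have E1 (f : {ffun V -> L}) : expR (t * (hits N B f)%:R) = \prod_u F u (f u).
  rewrite /F -big_mkcond /= prodr_const mulr_natr -expRM_natl.
  by rewrite /hits cardsE mulr_natl.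
transitivity (\sum_(f : {ffun V -> L}) \prod_u F u (f u)).
  by apply: eq_bigr => f _; exact: E1.
rewrite -(bigA_distr_bigA F) /=.
have E2 u : \sum_a F u a = #|L|%:R * (if u \in N then 1 + (expR t - 1) * prob (B u) else 1).
  have L0 : (#|L|%:R : R) != 0 by rewrite pnatr_eq0 -lt0n.
  rewrite /F; case: (u \in N) => /=; last by rewrite sumr_const mulr1.
  have -> : \sum_a (if a \in B u then expR t else 1) =
            \sum_(a : L) (1 + (expR t - 1) * (a \in B u)%:R) :> R.
    by apply: eq_bigr => a _; case: (a \in B u); rewrite ?mulr1 ?mulr0; ring.
  rewrite big_split /= sumr_const -mulr_sumr -natr_sum.
  have -> : (\sum_(a : L) (a \in B u))%N = #|B u|.
    by rewrite -sum1_card [RHS]big_mkcond; apply: eq_bigr => a _; case: (a \in B u).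
  by rewrite /prob; field.
rewrite (eq_bigr _ (fun u _ => E2 u)).
rewrite big_split /= prodr_const card_ffun natrX; congr (_ * _).
by rewrite [RHS]big_mkcond.
Qed.


(** Markov's inequality for the exponential moment at t = eps / 4: the exponent is
    at most (t + 2 t^2) mu - t (mu + eps |N|), and mu <= |N|. *)
Lemma chernoff (N : {set V}) (B : V -> {set L}) (eps : R) : 0 <= eps <= 1 ->
  #|[set f | \sum_(u in N) prob (B u) + eps * #|N|%:R < (hits N B f)%:R]|%:R <=
  expR (- (eps ^+ 2 / 8 * #|N|%:R)) * #|{: {ffun V -> L}}|%:R.
Proof.
move=> /andP [e0 e1]; set mu := \sum_(u in N) _; set A := [set f | _].
pose t := eps / 4.
have t0 : 0 <= t <= 4^-1 by apply/andP; split; rewrite /t; lra.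
have mu_le : mu <= #|N|%:R.
  rewrite -sum1_card natr_sum; apply: ler_sum => u _; exact: prob_le1.
have mu0 : 0 <= mu by apply: sumr_ge0 => u _; exact: prob_ge0.
have markov : #|A|%:R * expR (t * (mu + eps * #|N|%:R)) <=
    \sum_(f : {ffun V -> L}) expR (t * (hits N B f)%:R).
  rewrite (bigID (mem A)) /= -[leLHS]addr0; apply: lerD; last first.
    by apply: sumr_ge0 => f _; exact: expR_ge0.
  rewrite mulr_natl -sumr_const; apply: ler_sum => f; rewrite inE => /ltW h.
  by rewrite ler_expR ler_wpM2l //; case/andP: t0.
have prod_le : \prod_(u in N) (1 + (expR t - 1) * prob (B u)) <=
    expR ((t + 2 * t ^+ 2) * mu).
  rewrite /mu mulr_sumr expR_sum; apply: ler_prod => u _.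
  have p0 := prob_ge0 (B u).
  have t1 : 0 <= expR t - 1.
    have := expR_ge1Dx t; case/andP: t0; lra.
  apply/andP; split; first by rewrite addr_ge0 // mulr_ge0.
  apply: le_trans (expR_ge1Dx _); rewrite lerD2l; apply: ler_wpM2r => //.
  have := expR_quadratic t0; lra.
have {markov} : #|A|%:R * expR (t * (mu + eps * #|N|%:R)) <=
    #|{: {ffun V -> L}}|%:R * expR ((t + 2 * t ^+ 2) * mu).
  apply: le_trans markov _; rewrite exp_moment; exact: ler_wpM2l.
rewrite -ler_pdivlMr ?expR_gt0 // => /le_trans; apply.
rewrite -[leLHS]mulrA -expRN -expRD mulrC; apply: ler_wpM2r => //.
rewrite ler_expR /t.
have : 0 <= eps ^+ 2 * (#|N|%:R - mu) by rewrite mulr_ge0 ?sqr_ge0 ?subr_ge0.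
rewrite !expr2; nra.
Qed.

End Chernoff.

(** * Typical labellings *)

Definition nbhd (V : finType) (e : rel V) (v : V) : {set V} := [set u | e v u].

Section TypicalLabelling.
Variable R : realType.

Lemma hits_setC (V L : finType) (N : {set V}) (B : V -> {set L}) f :
  (hits N (fun u => ~: B u) f + hits N B f = #|N|)%N.
Proof.
rewrite /hits -[RHS](cardsID [set u | f u \in B u] N) addnC; congr (_ + _)%N.
  by apply: eq_card => u; rewrite !inE.
by apply: eq_card => u; rewrite !inE andbC.
Qed.

Lemma sum_probC (V L : finType) (N : {set V}) (B : V -> {set L}) : (0 < #|L|)%N ->
  \sum_(u in N) prob R (~: B u) = #|N|%:R - \sum_(u in N) prob R (B u).
Proof.
move=> L0; rewrite (eq_bigr _ (fun u _ => probC R L0 (B u))) big_split /= sumrN.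
by rewrite sumr_const.
Qed.

Lemma second_nbhd_card (V : finType) (e : rel V) (Delta : nat) (v : V) :
  symmetric e -> (forall u, (#|nbhd e u| <= Delta)%N) ->
  (#|[set u | ~~ [disjoint nbhd e v & nbhd e u]]| <= Delta ^ 2)%N.
Proof.
move=> e_sym leD.
have sub : [set u | ~~ [disjoint nbhd e v & nbhd e u]] \subset
    \bigcup_(w in nbhd e v) nbhd e w.
  apply/subsetP => u; rewrite inE => /pred0Pn [w /andP [vw uw]].
  by apply/bigcupP; exists w => //; move: uw; rewrite /= !inE e_sym.
apply: leq_trans (subset_leq_card sub) _.
apply: (@leq_trans (\sum_(w in nbhd e v) #|nbhd e w|)).
  apply: (big_rec2 (fun (x : {set V}) k => #|x| <= k)%N); first by rewrite cards0.
  move=> w y1 y2 _ h; apply: (leq_trans (leq_card_setU _ _)).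
  by rewrite leq_add2l.
apply: (@leq_trans (\sum_(w in nbhd e v) Delta)); first exact: leq_sum.
by rewrite sum_nat_const expnS expn1 leq_mul2r leD orbT.
Qed.

(** If the minimum degree is at least a large multiple of log Delta, then for
    every family of at most Delta^m counting events there is a labelling for
    which all counts, in all neighbourhoods, are close to their means.  Chernoff
    is applied to each set of labels and to its complement, which bounds the
    count from both sides. *)
Theorem typical_labelling (eps : R) (m : nat) : 0 < eps <= 1 ->
  exists2 C : R, 0 <= C &
  forall (V L I : finType) (e : rel V) (Delta : nat) (B : I -> V -> V -> {set L}),
    symmetric e -> (0 < #|L|)%N -> (1 < Delta)%N -> (#|I| <= Delta ^ m)%N ->
    (forall v, (#|nbhd e v| <= Delta)%N) ->
    (forall v, C * ln Delta%:R <= #|nbhd e v|%:R) ->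
  exists f : {ffun V -> L}, forall v i,
    `|(hits (nbhd e v) (B i v) f)%:R - \sum_(u in nbhd e v) prob R (B i v u)|
      <= eps * #|nbhd e v|%:R.
Proof.
move=> /andP [e0 e1].
(* Two sides, Delta^m events at a vertex, Delta^2 dependent vertices and the
   factor 4 of the local lemma: 8 Delta^(m+2) <= Delta^(m+5). *)
pose n := (m + 5)%N.
exists (8 * n%:R / eps ^+ 2); first by rewrite divr_ge0 ?sqr_ge0 ?mulr_ge0.
move=> V L I e Delta B e_sym L0 D1 cI leD geC.
have De0 : (0 : R) < Delta%:R by rewrite ltr0n; lia.
pose above v (B' : V -> {set L}) : {set {ffun V -> L}} := [set f |
  \sum_(u in nbhd e v) prob R (B' u) + eps * #|nbhd e v|%:R
    < (hits (nbhd e v) B' f)%:R].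
pose A v := \bigcup_(i : I)
  (above v (B i v) :|: above v (fun u => ~: B i v u)).
pose p : R := 2 * Delta%:R ^+ m / Delta%:R ^+ n.
have Dn0 : 0 < Delta%:R ^+ n :> R by rewrite exprn_gt0.
have above_le v B' : #|above v B'|%:R <=
    (Delta%:R ^+ n)^-1 * #|{: {ffun V -> L}}|%:R :> R.
  have := @chernoff R V L L0 (nbhd e v) B' eps _; rewrite (ltW e0) e1 => /(_ isT).
  move/le_trans; apply; apply: ler_wpM2r => //.
  rewrite expRN lef_pV2 ?posrE ?expR_gt0 //.
  rewrite -[X in X ^+ n]lnK ?posrE // -expRM_natl ler_expR.
  have e2 : 0 < eps ^+ 2 by rewrite exprn_gt0.
  have := geC v; rewrite -(ler_pM2l e2) => h.
  have -> : n%:R * ln Delta%:R = eps ^+ 2 * (8 * n%:R / eps ^+ 2 * ln Delta%:R) / 8 :> R.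
    by field; rewrite lt0r_neq0.
  lra.
have Om0 : (0 < #|{: {ffun V -> L}}|)%N by rewrite card_ffun expn_gt0 L0.
have leAp v : #|A v|%:R <= p * #|{: {ffun V -> L}}|%:R.
  have : (#|A v| <= \sum_(i : I) (#|above v (B i v)| +
                    #|above v (fun u => ~: B i v u)|))%N.
    apply: (big_rec2 (fun (x : {set {ffun V -> L}}) k => #|x| <= k)%N).
      by rewrite cards0.
    move=> i y1 y2 _ h; apply: (leq_trans (leq_card_setU _ _)).
    by apply: leq_add => //; exact: leq_card_setU.
  rewrite -(ler_nat R) natr_sum => /le_trans; apply.
  apply: (@le_trans _ _ (\sum_(i : I) 2 * ((Delta%:R ^+ n)^-1 * #|{: {ffun V -> L}}|%:R))).
    apply: ler_sum => i _; rewrite natrD.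
    by have := above_le v (B i v); have := above_le v (fun u => ~: B i v u); lra.
  rewrite sumr_const -[leLHS]mulr_natl.
  have -> : p * #|{: {ffun V -> L}}|%:R =
      Delta%:R ^+ m * (2 * ((Delta%:R ^+ n)^-1 * #|{: {ffun V -> L}}|%:R)).
    by rewrite /p; ring.
  apply: ler_wpM2r; last by rewrite -natrX ler_nat.
  by rewrite !mulr_ge0 // invr_ge0 ltW.
have [f Hf] : exists f, forall v, f \notin A v.
  apply: (@local_lemma R _ _ A (fun v u => ~~ [disjoint nbhd e v & nbhd e u])
            p (Delta ^ 2)%N) => //.
  - by move=> v; apply: second_nbhd_card.
  - move=> v S hS; rewrite -[X in (_ * X)%N]cardsT.
    have A_loc u (f g : {ffun V -> L}) : {in nbhd e u, f =1 g} -> (f \in A u) = (g \in A u).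
      move=> fg; have hitsE B' : hits (nbhd e u) B' f = hits (nbhd e u) B' g.
        apply: eq_card => w; rewrite !inE; case: (boolP (e u w)) => //= uw.
        by rewrite fg // inE.
      by apply/bigcupP/bigcupP => -[i _ h]; exists i => //; move: h;
        rewrite !inE !hitsE.
    apply: (@disjoint_support_indep V L (nbhd e v)) => f g fg; first exact: A_loc.
    rewrite !inE; apply: eq_forallb_in => u uS; congr (~~ _); apply: A_loc => w uw.
    apply: fg; rewrite inE; apply/negP => vw.
    have := hS _ uS; rewrite negbK => /pred0P /(_ w) /=; by rewrite vw uw.
  - by rewrite expn_gt0; lia.
  - rewrite /p natrX /n.
    have D2 : 2 <= Delta%:R :> R by rewrite ler_nat.
    have Dm0 : 0 < Delta%:R ^+ m :> R by rewrite exprn_gt0.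
    have -> : 4 * (2 * Delta%:R ^+ m / Delta%:R ^+ (m + 5)) * Delta%:R ^+ 2 =
              8 / Delta%:R ^+ 3 :> R.
      by rewrite exprD; field; rewrite !lt0r_neq0.
    rewrite ler_pdivrMr ?exprn_gt0 // mul1r.
    have -> : 8 = 2 ^+ 3 :> R by ring.
    by rewrite lerXn2r ?nnegrE // ltW.
exists f => v i; have := Hf v; rewrite /A => /bigcupP nA.
have : f \notin above v (B i v) :|: above v (fun u => ~: B i v u).
  by apply/negP => h; apply: nA; exists i.
rewrite !inE negb_or -!leNgt sum_probC // => /andP [h1 h2].
have := hits_setC (nbhd e v) (B i v) f; move/(congr1 (fun k => k%:R : R)).
by rewrite natrD => h3; rewrite ler_norml; apply/andP; split; lra.
Qed.

End TypicalLabelling.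

(** * Greedy choices *)

Lemma subset_of_card (T : finType) (A : {set T}) k : (k <= #|A|)%N ->
  exists2 B : {set T}, B \subset A & #|B| = k.
Proof.
move=> kA; exists [set x in take k (enum A)].
  by apply/subsetP => x; rewrite inE => /mem_take; rewrite mem_enum.
rewrite cardsE (card_uniqP _) ?take_uniq ?enum_uniq //.
by rewrite size_takel // -cardE.
Qed.

(** Greedy list colouring in the order given by [r]: the values taken by the
    conflicting predecessors do not exhaust the list. *)
Lemma greedy_choice (V : finType) (X : eqType) (x0 : X) (c : rel V)
    (r : V -> nat) (A : V -> seq X) :
  symmetric c -> injective r -> (forall v, uniq (A v)) ->
  (forall v, (#|[set u | c v u & r u < r v]| < size (A v))%N) ->
  exists2 t : V -> X, (forall v, t v \in A v) &
    forall u v, c u v -> u != v -> t u != t v.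
Proof.
move=> c_sym r_inj uA ltA.
have step n : exists t : V -> X, forall v, (r v < n)%N ->
    t v \in A v /\ (forall u, c v u -> (r u < r v)%N -> t u != t v).
  elim: n => [|n [t Ht]]; first by exists (fun=> x0).
  case: (pickP (fun v => r v == n)) => [v /eqP rv|no]; last first.
    exists t => v; rewrite ltnS leq_eqVlt => /orP [h|]; last exact: Ht.
    by rewrite no in h.
  have [x xA xN] : exists2 x, x \in A v & x \notin [seq t u | u in [set u | c v u & (r u < r v)%N]].
    apply/hasP; apply/negPn/negP => /hasPn H.
    have : {subset A v <= [seq t u | u in [set u | c v u & (r u < r v)%N]]}.
      by move=> x /H; rewrite negbK.
    move/(uniq_leq_size (uA v)); rewrite size_map -cardE leqNgt; by rewrite ltA.
  exists (fun u => if u == v then x else t u) => w; rewrite ltnS leq_eqVlt.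
  case: (eqVneq w v) => [-> _|wv].
    rewrite ?eqxx; split=> // u vu uv; case: (eqVneq u v) => [uE|_]; first by rewrite uE ltnn in uv.
    by apply: contraNneq xN => <-; apply: image_f; rewrite inE vu uv.
  case/orP => [/eqP rw|rw].
    by case/negP: wv; apply/eqP/r_inj; rewrite rw.
  have [h1 h2] := Ht w rw; split => // u wu uw; case: (eqVneq u v) => [uE|_]; last exact: h2.
  by move: uw; rewrite uE rv => /leq_trans - /(_ _ (ltnW rw)); rewrite ltnn.
have [t Ht] := step (\max_v r v).+1.
have lt_r v : (r v < (\max_v r v).+1)%N by rewrite ltnS; apply: (leq_bigmax v).
exists t => [v|u v cuv]; first by case: (Ht v (lt_r v)).
move=> uv; case: (ltngtP (r u) (r v)) => [h|h|/r_inj h].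
- by have [_ H] := Ht v (lt_r v); apply: H; rewrite // c_sym.
- by have [_ H] := Ht u (lt_r u); rewrite eq_sym; apply: H.
- by rewrite h eqxx in uv.
Qed.

(** Partial sums of signs fill an interval of integers, whatever the signs are:
    use only the positive or only the negative ones. *)
Lemma signed_subset_sum (T : finType) (U : {set T}) (tau : T -> int) (k : int) :
  (forall u, u \in U -> tau u = 1 \/ tau u = -1) ->
  - (#|[set u in U | tau u == -1]|%:Z) <= k <= #|[set u in U | tau u == 1]|%:Z ->
  exists2 Y : {set T}, Y \subset U & \sum_(u in Y) tau u = k.
Proof.
move=> tauP /andP [k1 k2].
have sums (s : int) (Y : {set T}) : Y \subset [set u in U | tau u == s] ->
    \sum_(u in Y) tau u = s *+ #|Y|.
  move=> /subsetP sY; rewrite -sumr_const; apply: eq_bigr => u /sY.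
  by rewrite inE => /andP [_ /eqP].
case: (lerP 0 k) => k0.
  have [|Y sY cY] := @subset_of_card T [set u in U | tau u == 1] `|k|%N; first lia.
  exists Y; last by rewrite (sums _ _ sY) cY; lia.
  by apply: subset_trans sY _; apply/subsetP => u; rewrite inE => /andP [].
have [|Y sY cY] := @subset_of_card T [set u in U | tau u == -1] `|k|%N; first lia.
exists Y; last by rewrite (sums _ _ sY) cY; lia.
by apply: subset_trans sY _; apply/subsetP => u; rewrite inE => /andP [].
Qed.

Lemma signed_card (T : finType) (U : {set T}) (tau : T -> int) :
  (forall u, u \in U -> tau u = 1 \/ tau u = -1) ->
  (#|[set u in U | tau u == -1%R]| + #|[set u in U | tau u == 1%R]| = #|U|)%N.
Proof.
move=> tauP; rewrite -(cardsID [set u | tau u == -1] U); congr (_ + _)%N.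
  by apply: eq_card => u; rewrite !inE.
apply: eq_card => u; rewrite !inE; case: (boolP (u \in U)); rewrite ?andbF //.
by move=> /tauP [] ->.
Qed.

(** * Separating the vertices of W by pairs *)

Section PairStage.
Variables (V : finType) (e : rel V) (W : {set V}) (r : V -> nat) (b : V -> bool).
Variables (s : V -> int) (P : rel V).
Hypotheses (e_sym : symmetric e) (e_irr : irreflexive e).
Hypothesis eW : forall u v, e u v -> v \in W.
Hypothesis r_inj : injective r.

(** The edges owned by [v].  An edge belongs to its later end if the ends have
    equal bits and to its earlier end otherwise; with random bits, a vertex owns
    about half of its edges wherever it stands in the order. *)
Definition usable (v : V) : {set V} :=
  [set u | e v u & (if (r u < r v)%N then b u == b v else b u != b v)].

(** [P] marks the possible conflicts; other neighbours start too far apart to meet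
    even if every inner edge at both of them is changed. *)
Hypothesis far : forall u v, e v u -> ~~ P v u ->
  (1 + #|nbhd e u| + #|nbhd e v| < `|s u - s v|)%N.
Hypothesis rich : forall v, v \in W ->
  (6 * (#|[set u | e v u & P v u]| + 1) <= #|usable v|)%N.

Definition total (x : V -> V -> int) (v : V) : int :=
  s v + \sum_(u in nbhd e v) x v u.

(** The sum lies in one of the pairs {6k+4, 6k+5}, which is then identified by
    its quotient by 6. *)
Definition paired (t : int) : Prop := (4 <= t %% 6)%Z.

Lemma total_near (x : V -> V -> int) v : (forall u w, `|x u w|%R <= 1) ->
  (`|(total x v - s v)%R| <= #|nbhd e v|)%N.
Proof.
move=> x1; rewrite -lez_nat abszE /total addrC addKr.
apply: le_trans (ler_norm_sum _ _ _) _.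
by rewrite -sum1_card -[Posz _]natz natr_sum; apply: ler_sum => u _; exact: x1.
Qed.

(** The state once all vertices of rank below [n] are settled: edges owned by
    vertices still to come are untouched, settled vertices are in pairs, and
    adjacent settled vertices are in distinct pairs. *)
Definition pair_invariant n (x : V -> V -> int) : Prop :=
  [/\ forall u v, x u v = x v u,
      forall u v, `|x u v| <= 1,
      forall u v, ~~ e u v -> x u v = 0,
      forall u v, (r u < r v)%N ->
        (n <= (if b u == b v then r v else r u))%N -> x u v = 0 &
      (forall v, v \in W -> (r v < n)%N -> paired (total x v)) /\
      forall u v, e u v -> (r u < n)%N -> (r v < n)%N ->
        (total x u %/ 6)%Z != (total x v %/ 6)%Z].

Lemma usable_free n x v u : pair_invariant n x -> r v = n -> u \in usable v ->
  x v u = 0.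
Proof.
move=> [xs _ _ x0 _] rv; rewrite inE => /andP [evu].
case: (ltngtP (r u) (r v)) => [lt|lt|/r_inj uv].
- by move=> buv; rewrite xs; apply: x0 lt _; rewrite buv rv.
- by rewrite eq_sym => /negbTE buv; apply: x0 lt _; rewrite buv rv.
- by rewrite uv e_irr in evu.
Qed.

(** The change [v] may apply to an owned edge to [u].  A settled [u] moves inside
    its pair; an unsettled [u] can absorb any change. *)
Definition toggle x (v u : V) : int :=
  if (r u < r v)%N && (total x u %% 6 == 5)%Z then -1 else 1.

Definition update (x : V -> V -> int) (v : V) (Y : {set V}) (tau : V -> int) u w : int :=
  x u w + ((if (u == v) && (w \in Y) then tau w else 0)
         + (if (w == v) && (u \in Y) then tau u else 0)).

Lemma total_update x v (Y : {set V}) tau u : Y \subset nbhd e v ->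
  total (update x v Y tau) u = total x u +
    ((if u == v then \sum_(w in Y) tau w else 0) + (if u \in Y then tau u else 0)).
Proof.
move=> /subsetP sY; rewrite /total /update big_split /= big_split /= -!addrA.
congr (_ + (_ + (_ + _))).
  case: (eqVneq u v) => [->|_] /=; last by rewrite big1.
  rewrite -big_mkcondr /=; apply: eq_bigl => w.
  by case: (boolP (w \in Y)) => [/sY ->|]; rewrite ?andbF.
case: (boolP (u \in Y)) => [uY|_]; last by rewrite big1 // => w _; rewrite andbF.
have vu : v \in nbhd e u by have := sY _ uY; rewrite !inE e_sym.
rewrite (bigD1 v) //= eqxx big1 ?addr0 // => w /andP [_ /negbTE ->] //.
Qed.

Lemma update_cases n x v (Y : {set V}) tau u w : pair_invariant n x -> r v = n ->
  Y \subset usable v ->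
  update x v Y tau u w = if (u == v) && (w \in Y) then tau w
    else if (w == v) && (u \in Y) then tau u else x u w.
Proof.
move=> inv rv /subsetP sY; rewrite /update.
have vY : v \notin Y by apply/negP => /sY; rewrite inE e_irr.
case: (eqVneq u v) => [->|_] /=; rewrite ?(negbTE vY) ?andbF ?addr0 ?add0r.
  by case: ifP => [/sY h|_]; rewrite ?addr0 // (usable_free inv rv h) add0r.
case: ifP => [/andP [/eqP -> /sY h]|_]; last by rewrite addr0.
by have [-> _ _ _ _] := inv; rewrite (usable_free inv rv h) add0r.
Qed.

Lemma toggle_sign x v u : toggle x v u = 1 \/ toggle x v u = -1.
Proof. by rewrite /toggle; case: ifP; [right|left]. Qed.

Lemma update_le1 n x v (Y : {set V}) : pair_invariant n x -> r v = n ->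
  Y \subset usable v -> forall u w, `|update x v Y (toggle x v) u w| <= 1.
Proof.
move=> inv rv sY u w; rewrite (update_cases _ _ _ inv rv sY).
have [_ x1 _ _ _] := inv; have tog u' := toggle_sign x v u'.
by case: ifP => _; [|case: ifP => _ //]; [case: (tog w)|case: (tog u)] => ->.
Qed.

Lemma subset_usable v (Y : {set V}) : Y \subset usable v -> Y \subset nbhd e v.
Proof.
move/subset_trans; apply; by apply/subsetP => w; rewrite !inE => /andP [].
Qed.

(** The sums within reach of [v] are #|usable v| + 1 consecutive integers, so they
    contain one more pair than there are possibly conflicting neighbours.  A
    settled neighbour that is not a possible conflict is too far away: no vertex
    ever moves by more than its degree. *)
Lemma pair_target x n v : pair_invariant n x -> v \in W -> r v = n ->
  exists2 Y : {set V}, Y \subset usable v &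
    let t := total x v + \sum_(u in Y) toggle x v u in
    (t %% 6 == 4)%Z /\ forall u, e v u -> (r u < n)%N -> (total x u %/ 6 != t %/ 6)%Z.
Proof.
move=> inv vW rv; have [xs x1 x0 xf [px dx]] := inv.
set S := usable v; pose tau := toggle x v.
have tauP u : u \in S -> tau u = 1 \/ tau u = -1.
  by move=> _; exact: toggle_sign.
pose np := #|[set u in S | tau u == 1]|; pose nn := #|[set u in S | tau u == -1]|.
have cS : (nn + np = #|S|)%N.
  exact: signed_card.
pose Z := [set u | e v u & P v u]; pose m := (#|Z| + 1)%N.
have mS : (6 * m <= #|S|)%N by apply: rich.
(* The least quotient whose lower pair element is within reach. *)
pose k0 : int := ((total x v - nn%:Z - 4 + 5) %/ 6)%Z.
pose f (i : 'I_m) : int := k0 + i%:Z.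
have f_reach (i : 'I_m) : - nn%:Z <= 6 * f i + 4 - total x v <= np%:Z.
  by have := ltn_ord i; rewrite /f /k0; lia.
have [i fi] : exists i : 'I_m, f i \notin [seq (total x u %/ 6)%Z | u in Z].
  case: (pickP (fun i => f i \notin [seq (total x u %/ 6)%Z | u in Z])) => [i fi|H].
    by exists i.
  have : {subset [seq f i | i : 'I_m] <= [seq (total x u %/ 6)%Z | u in Z]}.
    by move=> k /mapP [i _ ->]; have /negbFE := H i.
  have uf : uniq [seq f i | i : 'I_m].
    by rewrite map_inj_uniq ?enum_uniq // => i j; rewrite /f => /addrI [] /val_inj.
  move/(uniq_leq_size uf); rewrite !size_image card_ord /m; lia.
have [Y sY sumY] := signed_subset_sum tauP (f_reach i).
exists Y => //=; rewrite sumY.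
have tE : total x v + (6 * f i + 4 - total x v) = 6 * f i + 4 by ring.
rewrite tE; split; first by apply/eqP; lia.
move=> u evu ru; have uW := eW evu.
have := px u uW ru; rewrite /paired => pu.
have -> : ((6 * f i + 4) %/ 6)%Z = f i by lia.
apply: contraNneq fi => tu; rewrite -tu.
suff uZ : u \in Z by apply/imageP; exists u.
rewrite inE evu /=; apply/negPn/negP => nP.
have := far evu nP.
have sYn := subset_usable sY.
have v_notin : v \notin Y.
  by apply/negP => /(subsetP sYn); rewrite inE e_irr.
have := total_near u x1; have := total_near v (update_le1 inv rv sY).
rewrite (total_update _ _ _ sYn) eqxx (negbTE v_notin) sumY addr0 tE.
lia.
Qed.

Lemma pair_step n x v : pair_invariant n x -> v \in W -> r v = n ->
  exists x', pair_invariant n.+1 x'.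
Proof.
move=> inv vW rv; have [Y sY /= [t4 tN]] := pair_target inv vW rv.
have sYn := subset_usable sY.
have upd u w := update_cases (toggle x v) u w inv rv sY.
have v_notin : v \notin Y.
  by apply/negP => /(subsetP sYn); rewrite inE e_irr.
have totv : total (update x v Y (toggle x v)) v =
    total x v + \sum_(u in Y) toggle x v u.
  by rewrite (total_update _ _ _ sYn) eqxx (negbTE v_notin) addr0.
have totu u : u != v -> total (update x v Y (toggle x v)) u =
    total x u + (if u \in Y then toggle x v u else 0).
  by move=> /negbTE uv; rewrite (total_update _ _ _ sYn) uv add0r.
have [xs x1 x0 xf [px dx]] := inv.
have same u : u \in W -> (r u < n)%N ->
    paired (total (update x v Y (toggle x v)) u) /\
    (total (update x v Y (toggle x v)) u %/ 6)%Z = (total x u %/ 6)%Z.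
  move=> uW ru; have uv : u != v by apply: contraTneq ru => ->; rewrite rv ltnn.
  rewrite (totu _ uv); have := px u uW ru; rewrite /paired /toggle rv ru /=.
  by case: ifP => _; [case: eqP => h|]; lia.
exists (update x v Y (toggle x v)); split.
- by move=> u w; rewrite /update xs; congr (_ + _); rewrite addrC.
- exact: update_le1 inv rv sY.
- move=> u w euw; rewrite upd; case: ifP => [/andP [/eqP uv /(subsetP sYn)]|_].
    by rewrite inE -uv (negbTE euw).
  case: ifP => [/andP [/eqP wv /(subsetP sYn)]|_]; last exact: x0.
  by rewrite inE e_sym -wv (negbTE euw).
- move=> u w ltuw own; rewrite upd; case: ifP => [/andP [/eqP uv /(subsetP sY)]|_].
    rewrite inE -uv ltnNge (ltnW ltuw) /= => /andP [_ bwu].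
    by move: own; rewrite eq_sym (negbTE bwu) uv rv ltnn.
  case: ifP => [/andP [/eqP wv /(subsetP sY)]|_]; last by apply: xf ltuw _; apply: ltnW.
  by rewrite inE -wv ltuw => /andP [_ buw]; move: own; rewrite buw wv rv ltnn.
split.
- move=> u uW; rewrite ltnS leq_eqVlt => /orP [/eqP ru|ru]; last by case: (same u uW ru).
  have -> : u = v by apply: r_inj; rewrite ru.
  by rewrite /paired totv (eqP t4).
- have first u : e v u -> (r u < n)%N -> (total (update x v Y (toggle x v)) u %/ 6)%Z !=
      (total (update x v Y (toggle x v)) v %/ 6)%Z.
    by move=> evu ru; have [_ ->] := same u (eW evu) ru; rewrite totv; apply: tN.
  move=> u w euw; rewrite !ltnS (leq_eqVlt (r u)) (leq_eqVlt (r w)).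
  case/orP => [/eqP ru|ru]; case/orP => [/eqP rw|rw].
  + by move: euw; rewrite (r_inj (etrans ru (esym rw))) e_irr.
  + have uv : u = v by apply: r_inj; rewrite ru.
    by rewrite uv eq_sym; apply: first => //; rewrite -uv.
  + have wv : w = v by apply: r_inj; rewrite rw.
    by rewrite wv; apply: first => //; rewrite -wv e_sym.
  + have uW : u \in W by apply: (eW (u := w)); rewrite e_sym.
    have wW : w \in W by apply: (eW euw).
    by have [_ ->] := same u uW ru; have [_ ->] := same w wW rw; apply: dx.
Qed.

Lemma pair_stage : exists x : V -> V -> int,
  [/\ forall u v, x u v = x v u, forall u v, `|x u v| <= 1,
      forall u v, ~~ e u v -> x u v = 0,
      forall v, v \in W -> paired (total x v) &
      forall u v, e u v -> total x u <> total x v].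
Proof.
have [x [xs x1 x0 _ [px dx]]] : exists x, pair_invariant (\max_v r v).+1 x.
  elim: (\max_v r v).+1 => [|n [x inv]].
    by exists (fun _ _ => 0); split => // u v; rewrite normr0.
  case: (pickP (fun v => (v \in W) && (r v == n))) => [v /andP [vW /eqP rv]|no].
    exact: pair_step inv vW rv.
  have ltW u : u \in W -> (r u < n.+1)%N -> (r u < n)%N.
    rewrite ltnS leq_eqVlt => uW /orP [ru|//].
    by have := no u; rewrite uW ru.
  exists x; have [xs x1 x0 xf [px dx]] := inv; split => //.
    by move=> u v uv h; apply: xf uv _; apply: ltnW.
  split=> [v vW /(ltW v vW)|u v euv]; first exact: px.
  have uW : u \in W by apply: (eW (u := v)); rewrite e_sym.
  by move=> /(ltW u uW) ru /(ltW v (eW euv)) rv'; apply: dx.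
have lt_r v : (r v < (\max_v r v).+1)%N by rewrite ltnS; apply: (leq_bigmax v).
exists x; split => // [v vW|u v euv E]; first exact: px.
by have := dx u v euv (lt_r u) (lt_r v); rewrite E eqxx.
Qed.

End PairStage.

(** * From target sums to a weighting *)

Section Assembly.
Variables (V : finType) (X : eqType) (e tune : rel V) (W : {set V}).
Variables (w0 : V -> V -> nat) (r r1 : V -> nat) (b : V -> bool).
Variables (cell : nat -> X) (A : V -> seq nat).
Hypotheses (e_sym : symmetric e) (e_irr : irreflexive e).
Hypotheses (tune_sym : symmetric tune) (tune_e : forall u v, tune u v -> e u v).
Hypothesis tune_cross : forall u v, tune u v -> (u \in W) = (v \notin W).
Hypotheses (w0_sym : forall u v, w0 u v = w0 v u).
Hypothesis w0_range : forall u v, (1 <= w0 u v <= 3)%N.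
Hypothesis w0_tunable : forall u v,
  tune u v || [&& e u v, u \in W & v \in W] -> w0 u v = 2.
Hypotheses (r_inj : injective r) (r1_inj : injective r1).

Definition weight_sum (w : V -> V -> nat) (v : V) : nat :=
  (\sum_(u in nbhd e v) w v u)%N.

Definition inner : rel V := [rel u v | [&& e u v, u \in W & v \in W]].

Notation s0 := (weight_sum w0).

Hypothesis A_uniq : forall v, uniq (A v).
Hypothesis A_mod : forall v t, v \notin W -> t \in A v -> (t %% 6 < 4)%N.
Hypothesis A_cell : forall v t, v \notin W -> t \in A v -> cell t = cell (s0 v).
Hypothesis A_reach : forall v t, v \notin W -> t \in A v ->
  (`|t%:Z - (s0 v)%:Z|%R <= #|nbhd tune v|%:Z).
Hypothesis A_large : forall v, v \notin W ->
  (#|[set u | [&& e v u, u \notin W, cell (s0 u) == cell (s0 v) & (r1 u < r1 v)%N]]|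
    < size (A v))%N.
(** This is required for every outcome [s1] of the first stage, since the tunable
    edges also move the sums inside [W]. *)
Hypothesis W_rich : forall s1 : V -> int,
  (forall v, `|s1 v - (s0 v)%:Z| <= #|nbhd tune v|%:Z) ->
  forall v, v \in W ->
  (6 * (#|[set u | inner v u & (`|(s1 u - s1 v)%R| <=
             1 + #|nbhd inner u| + #|nbhd inner v|)%N]| + 1)
   <= #|usable inner r b v|)%N.

Lemma outer_targets : exists t : V -> nat,
  [/\ forall v, v \notin W -> (t v %% 6 < 4)%N,
      forall v, v \notin W -> `|(t v)%:Z - (s0 v)%:Z| <= #|nbhd tune v|%:Z &
      forall u v, u \notin W -> v \notin W -> e u v -> t u != t v].
Proof.
pose c := [rel u v | [&& e u v, u \notin W, v \notin W & cell (s0 u) == cell (s0 v)]].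
have [||v|v|t tA tN] := @greedy_choice V nat 0%N c r1
    (fun v => if v \in W then [:: 0%N] else A v).
- by move=> u v; rewrite /= e_sym eq_sym; congr (_ && _); rewrite !andbA (andbC (u \notin W)).
- exact: r1_inj.
- by case: ifP.
- case: (boolP (v \in W)) => vW.
    rewrite (eq_card0 (A := [set u | c v u & _])) // => u.
    by rewrite !inE /= vW !andbF.
  apply: leq_ltn_trans (A_large vW); apply: subset_leq_card; apply/subsetP => u.
  rewrite !inE /= => /andP [/and4P [-> _ -> /eqP ->] ->].
  by rewrite eqxx.
have tA' v : v \notin W -> t v \in A v by move=> vW; have := tA v; rewrite (negbTE vW).
exists t; split => [v vW|v vW|u v uW vW euv].
- exact: A_mod (tA' v vW).
- exact: A_reach (tA' v vW).
case: (boolP (c u v)) => [cuv|].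
  by apply: tN => //; apply: contraTneq euv => ->; rewrite e_irr.
rewrite /= euv uW vW /=; apply: contraNneq => tuv.
by rewrite -(A_cell uW (tA' u uW)) -(A_cell vW (tA' v vW)) tuv.
Qed.

(** A tunable edge has a single end outside [W], so every vertex outside [W] can
    correct its own sum without disturbing the others. *)
Lemma outer_stage (t : V -> nat) :
  (forall v, v \notin W -> `|(t v)%:Z - (s0 v)%:Z| <= #|nbhd tune v|%:Z) ->
  exists x : V -> V -> int,
  [/\ forall u v, x u v = x v u, forall u v, `|x u v| <= 1,
      forall u v, ~~ tune u v -> x u v = 0 &
      forall v, v \notin W -> (s0 v)%:Z + \sum_(u in nbhd e v) x v u = (t v)%:Z].
Proof.
move=> reach.
pose k v := (t v)%:Z - (s0 v)%:Z.
have [Y HY] : exists Y : V -> {set V}, forall v, v \notin W ->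
    Y v \subset nbhd tune v /\ #|Y v| = `|k v|%N.
  pose Q v (B : {set V}) := (v \notin W) ==> (B \subset nbhd tune v) && (#|B| == `|k v|%N).
  have exQ v : exists B, Q v B.
    case: (boolP (v \in W)) => vW; first by exists set0; rewrite /Q vW.
    have [|B sB cB] := @subset_of_card V (nbhd tune v) `|k v|%N.
      by have := reach v vW; rewrite -/(k v); lia.
    by exists B; rewrite /Q vW sB cB eqxx.
  exists (fun v => xchoose (exQ v)) => v vW.
  by have /implyP /(_ vW) /andP [sB /eqP cB] := xchooseP (exQ v).
pose on u w := (u \notin W) && (w \in Y u).
have onR u w : on u w -> tune u w.
  by move=> /andP [uW wY]; have [/subsetP /(_ _ wY)] := HY u uW; rewrite inE.
pose x u w : int := if on u w then sgz (k u) else if on w u then sgz (k w) else 0.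
have on_asym u w : on u w -> ~~ on w u.
  move=> ouw; have := tune_cross (onR _ _ ouw); case/andP: ouw => uW _.
  by rewrite /on (negbTE uW) => /esym /negbFE ->.
exists x; split => [u w|u w|u w nR|v vW].
- rewrite /x; case: (boolP (on u w)) => [/on_asym /negbTE ->|_] //.
- by rewrite /x; case: ifP => _; [|case: ifP => _ //]; rewrite /sgz; case: ifP => _ //; case: ifP.
- rewrite /x; case: ifP => [/onR h|_]; first by rewrite h in nR.
  by case: ifP => [/onR h|//]; rewrite tune_sym h in nR.
have [sY cY] := HY v vW.
have -> : \sum_(u in nbhd e v) x v u = \sum_(u in Y v) sgz (k v).
  rewrite [RHS]big_mkcond [LHS]big_mkcond /=; apply: eq_bigr => u _.
  rewrite /x /on vW inE /=; case: (boolP (u \in Y v)) => uY.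
    by have := subsetP sY _ uY; rewrite inE => /tune_e ->.
  case: (boolP ((u \notin W) && (v \in Y u))) => [ouv|_]; last by case: ifP.
  have := tune_cross (onR u v ouv); case/andP: ouv => uW _.
  by rewrite (negbTE uW) (negbTE vW).
rewrite sumr_const cY -mulr_natr natz.
have : sgz (k v) * `|k v|%N%:Z = k v by rewrite /sgz; case: eqP => h; [|case: ifP => h']; lia.
by rewrite /k; lia.
Qed.

(** Outside [W] the final sums are less than 4 modulo 6, inside they are 4 or 5,
    so the two stages have to separate neighbours of the same kind only. *)
Theorem assembly : exists w : V -> V -> nat,
  [/\ forall u v, w u v = w v u, forall u v, e u v -> (1 <= w u v <= 3)%N &
      forall u v, e u v -> weight_sum w u <> weight_sum w v].
Proof.
have [t [t_mod t_reach t_neq]] := outer_targets.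
have [x1 [x1s x1b x1R x1t]] := outer_stage t_reach.
pose s1 v := (s0 v)%:Z + \sum_(u in nbhd e v) x1 v u.
have s1_near v : `|s1 v - (s0 v)%:Z| <= #|nbhd tune v|%:Z.
  rewrite /s1 addrC addKr (bigID (fun u => tune v u)) /= [X in _ + X]big1 ?addr0; last first.
    by move=> u /andP [_ /x1R].
  apply: le_trans (ler_norm_sum _ _ _) _.
  apply: (le_trans (y := \sum_(u in nbhd e v | tune v u) 1)).
    by apply: ler_sum => u _; exact: x1b.
  rewrite -sum1_card -[Posz _]natz natr_sum le_eqVlt; apply/orP; left; apply/eqP.
  by apply: eq_bigl => u; rewrite !inE andbC; case: (boolP (tune v u)) => // /tune_e.
have inner_sym : symmetric inner.
  by move=> u v; rewrite /inner /= e_sym (andbC (u \in W)).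
have [||u v /and3P [] //|||v vW|x2 [x2s x2b x20 x2p x2n]] := @pair_stage V inner W r b s1
  (fun v u => `|(s1 u - s1 v)%R| <= 1 + #|nbhd inner u| + #|nbhd inner v|)%N.
- exact: inner_sym.
- by move=> u; rewrite /inner /= e_irr.
- exact: r_inj.
- by move=> u v _; rewrite -ltnNge.
- exact: W_rich s1_near v vW.
pose z u v : int := (w0 u v)%:Z + x1 u v + x2 u v.
have z_range u v : e u v -> 1 <= z u v <= 3.
  move=> euv; have := x1b u v; have := x2b u v; have := w0_range u v; rewrite /z.
  case: (boolP (tune u v)) => [Ruv|nR].
    rewrite (w0_tunable (v := v)) ?Ruv // (x20 u v); first by lia.
    by rewrite /inner /= euv /=; have := tune_cross Ruv; case: (u \in W); case: (v \in W).
  rewrite (x1R _ _ nR); case: (boolP (inner u v)) => [iuv|ni].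
    rewrite (w0_tunable (v := v)); first by lia.
    by rewrite [X in _ || X]iuv orbT.
  by rewrite (x20 _ _ ni); lia.
pose w u v := `|z u v|%N.
have wE v : (weight_sum w v)%:Z = s1 v + \sum_(u in nbhd e v) x2 v u.
  rewrite /weight_sum /w /s1 -[Posz _]natz natr_sum -[Posz (weight_sum _ _)]natz natr_sum.
  rewrite -!big_split /=; apply: eq_bigr => u; rewrite inE => /z_range.
  by rewrite !natz -/(z v u); lia.
have w_out v : v \notin W -> (weight_sum w v)%:Z = (t v)%:Z.
  move=> vW; rewrite wE /s1 x1t // big1 ?addr0 // => u _; apply: x20.
  by rewrite /inner /= (negbTE vW) andbF.
have w_in v : v \in W -> (weight_sum w v)%:Z = total inner s1 x2 v.
  move=> vW; rewrite wE /total; congr (_ + _).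
  rewrite [RHS]big_mkcond [LHS]big_mkcond /=; apply: eq_bigr => u _; rewrite !inE.
  case: (boolP (e v u)) => [evu|ne]; last by rewrite /inner /= (negbTE ne).
  by case: ifP => // /negbT /x20.
exists w; split => [u v|u v /z_range|u v euv E].
- by rewrite /w /z w0_sym x1s x2s.
- by rewrite /w; lia.
case: (boolP (u \in W)) => uW; case: (boolP (v \in W)) => vW.
- by apply: (x2n u v); rewrite /inner /= ?euv ?uW ?vW // -!w_in // E.
- have := x2p u uW; rewrite /paired -w_in // E w_out //; have := t_mod v vW; lia.
- have := x2p v vW; rewrite /paired -w_in // -E w_out //; have := t_mod u uW; lia.
- have := t_neq u v uW vW euv; have := w_out u uW; have := w_out v vW; rewrite E; lia.
Qed.

End Assembly.

(** * Edge sets and adjacency *)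

Section Translation.
Variable G : sgraph.
Local Notation e := (@adj G).

Lemma set2_eq (T : finType) (a b u v : T) : [set a; b] = [set u; v] ->
  (a = u /\ b = v) \/ (a = v /\ b = u).
Proof.
move=> E; have := set21 a b; have := set22 a b; rewrite E !inE.
have := set21 u v; have := set22 u v; rewrite -E !inE.
by do 4!case/orP => /eqP ?; subst; auto.
Qed.

Lemma incidentE (v : G) : incident v = [set [set v; u] | u in nbhd e v].
Proof.
apply/setP => f; rewrite !inE; apply/andP/imsetP => [[/imsetP [[a b]]]|[u]].
  rewrite inE /= => ab ->; rewrite !inE => /orP [] /eqP ->.
    by exists b; rewrite ?inE.
  by exists a; rewrite ?inE 1?adj_sym // setUC.
rewrite inE => vu ->; split; last by rewrite set21.
by apply/imsetP; exists (v, u); rewrite ?inE.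
Qed.

Lemma set2_inj (v : G) : {in nbhd e v &, injective (fun u => [set v; u])}.
Proof. by move=> u1 u2 _ _ /set2_eq [[_ //]|[<- ->]]. Qed.

Lemma degreeE (v : G) : degree v = #|nbhd e v|.
Proof. by rewrite /degree incidentE card_in_imset //; apply: set2_inj. Qed.

(** A symmetric function of the two ends and a function of the edge carry the same
    information. *)
Lemma edge_weighting (w : G -> G -> nat) : (forall u v, w u v = w v u) ->
  exists we : {set G} -> nat, (forall u v, e u v -> we [set u; v] = w u v) /\
    forall v, weighted_degree we v = weight_sum e w v.
Proof.
move=> w_sym.
pose we (f : {set G}) : nat :=
  if [pick p : G * G | e p.1 p.2 && (f == [set p.1; p.2])] is Some p
  then w p.1 p.2 else 0.
have weE u v : e u v -> we [set u; v] = w u v.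
  move=> uv; rewrite /we; case: pickP => [[a b] /= /andP [_ /eqP /set2_eq]|no].
    by case=> -[-> ->].
  by have := no (u, v); rewrite /= uv eqxx.
exists we; split=> // v; rewrite /weighted_degree incidentE big_imset /=; last first.
  exact: set2_inj.
by apply: eq_bigr => u; rewrite inE => /weE.
Qed.

Lemma weighting_of_matrix (w : G -> G -> nat) : (forall u v, w u v = w v u) ->
  (forall u v, e u v -> (1 <= w u v <= 3)%N) ->
  (forall u v, e u v -> weight_sum e w u <> weight_sum e w v) ->
  exists we : {set G} -> nat, weighting 3 we /\ vertex_colouring we.
Proof.
move=> w_sym w13 w_neq; have [we [weE wdE]] := edge_weighting w_sym.
exists we; split; last by move=> u v uv; rewrite !wdE; apply: w_neq.
by move=> f /imsetP [[a b]]; rewrite inE /= => ab ->; rewrite weE ?w13.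
Qed.

Lemma le_max_degree (v : G) : (#|nbhd e v| <= max_degree G)%N.
Proof. by rewrite -degreeE; apply: (leq_bigmax v). Qed.

Lemma min_degree_le (v : G) : (min_degree G <= #|nbhd e v|)%N.
Proof.
rewrite -degreeE /min_degree; have := mem_index_enum v.
elim: index_enum => // u s IHs; rewrite inE big_cons.
by case/orP => [/eqP <-|/IHs]; [exact: geq_minl | apply/leq_trans/geq_minr].
Qed.

End Translation.

(** * Random positions, classes and the set W *)

Lemma card_ord_geq (K c : nat) : #|[set x : 'I_K | (c <= x)%N]| = (K - c)%N.
Proof.
rewrite -sum1dep_card -(big_mkord (fun i => c <= i)%N (fun=> 1%N)).
elim: K => [|n IHn]; first by rewrite big_geq.
by rewrite big_mkcond big_nat_recr //= -big_mkcond IHn; case: leqP => h; lia.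
Qed.

Lemma card_ord_odd (h : nat) (b : bool) :
  #|[set y : 'I_(h.*2) | odd y == b]| = h.
Proof.
rewrite -sum1dep_card -(big_mkord (fun i => odd i == b) (fun=> 1%N)).
elim: h => [|h IHh]; first by rewrite big_geq.
rewrite doubleS big_mkcond !big_nat_recr //= -big_mkcond IHh odd_double.
by case: b {IHh} => /=; rewrite ?addn0 addn1.
Qed.

Section Rectangles.
Variables (R : realType) (K q : nat).
Hypotheses (K_gt0 : (0 < K)%N) (q_gt0 : (0 < q)%N).

Definition rect (X : {set 'I_K}) (Y Z : {set 'I_q}) : {set 'I_K * 'I_q * 'I_q} :=
  setX (setX X Y) Z.

Lemma prob_rect X Y Z :
  prob R (rect X Y Z) = (#|X|%:R / K%:R) * (#|Y|%:R / q%:R) * (#|Z|%:R / q%:R).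
Proof.
rewrite /prob !cardsX !card_prod !card_ord !natrM; field.
by rewrite !pnatr_eq0 -!lt0n K_gt0 q_gt0.
Qed.

End Rectangles.

Section Labels.
Variables (R : realType) (K h : nat).
Hypotheses (K_gt0 : (0 < K)%N) (h_gt0 : (0 < h)%N).
Local Notation q := (h.*2).
Local Notation z0 := (Ordinal (n := h.*2) (m := 0) (etrans (double_gt0 h) h_gt0)).

(** The labelling theorem for the counts used below.  The windows are arbitrary
    sets of positions, indexed by an integer up to 3 Delta that stands for a sum
    at the centre: the window can thus follow that sum although it depends on the
    labels itself. *)
Lemma typical_labels (eps : R) : 0 < eps <= 1 ->
  exists2 C : R, 0 <= C &
  forall (V : finType) (e : rel V) (Delta : nat) (r : V -> nat)
      (win1 win2 : nat -> V -> V -> pred 'I_K),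
    symmetric e -> (1 < Delta)%N ->
    (K.+1 * q.+1 + q.+1 + 2 + ((3 * Delta).+1 + (3 * Delta).+1) <= Delta ^ 2)%N ->
    (forall v, (#|nbhd e v| <= Delta)%N) ->
    (forall v, C * ln Delta%:R <= #|nbhd e v|%:R) ->
  exists (x : V -> 'I_K) (y : V -> 'I_q) (W : {set V}), forall v,
  let d : R := #|nbhd e v|%:R in
  [/\ forall c, (c <= K)%N ->
        `|#|[set u in nbhd e v | (c <= x u)%N]|%:R - (1 - c%:R / K%:R) * d| <= eps * d,
      forall c y0, (c <= K)%N ->
        `|#|[set u in nbhd e v | [&& (c <= x u)%N, y u == y0 & u \in W]]|%:R
          - (1 - c%:R / K%:R) / q%:R ^+ 2 * d| <= eps * d,
      `|#|[set u in nbhd e v | u \in W]|%:R - d / q%:R| <= eps * d &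
      forall y0, `|#|[set u in nbhd e v | y u == y0]|%:R - d / q%:R| <= eps * d] /\
  [/\ forall b : bool,
        `|#|[set u in nbhd e v | (u \in W) &
              (odd (y u) == (if (r u < r v)%N then b else ~~ b))]|%:R
          - d / (2 * q%:R)| <= eps * d,
      forall a, (a <= 3 * Delta)%N -> #|[set u in nbhd e v | win1 a v u (x u)]|%:R <=
        \sum_(u in nbhd e v) #|[set i | win1 a v u i]|%:R / K%:R + eps * d &
      forall a, (a <= 3 * Delta)%N ->
        #|[set u in nbhd e v | (u \in W) && win2 a v u (x u)]|%:R <=
        \sum_(u in nbhd e v) #|[set i | win2 a v u i]|%:R / K%:R / q%:R + eps * d].
Proof.
move=> heps; have [C C0 HC] := @typical_labelling R eps 2 heps.
exists C => // V e Delta r win1 win2 e_sym D1 big leD geC.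
have q_gt0 : (0 < q)%N by rewrite double_gt0.
pose I : finType := ('I_K.+1 * option 'I_q + option 'I_q + bool +
           ('I_(3 * Delta).+1 + 'I_(3 * Delta).+1))%type.
pose thr (c : nat) : {set 'I_K} := [set i : 'I_K | (c <= i)%N].
pose par (b : bool) : {set 'I_q} := [set i : 'I_q | odd i == b].
pose B (i : I) (v u : V) : {set 'I_K * 'I_q * 'I_q} :=
  match i with
  | inl (inl (inl (c, None))) => rect (thr c) setT setT
  | inl (inl (inl (c, Some y0))) => rect (thr c) [set y0] [set z0]
  | inl (inl (inr None)) => rect setT setT [set z0]
  | inl (inl (inr (Some y0))) => rect setT [set y0] setT
  | inl (inr b) => rect setT (par (if (r u < r v)%N then b else ~~ b)) [set z0]
  | inr (inl a) => rect [set i | win1 a v u i] setT setT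
  | inr (inr a) => rect [set i | win2 a v u i] setT [set z0]
  end.
have [||f Hf] := HC V ('I_K * 'I_q * 'I_q)%type I e Delta B e_sym _ D1 _ leD geC.
- by rewrite !card_prod !card_ord !muln_gt0 K_gt0 q_gt0.
- by rewrite !card_sum !card_prod !card_option !card_ord card_bool.
exists (fun v => (f v).1.1), (fun v => (f v).1.2), [set v | (f v).2 == z0] => v d.
have K0 : (K%:R : R) != 0 by rewrite pnatr_eq0 -lt0n.
have q0 : (q%:R : R) != 0 by rewrite pnatr_eq0 -lt0n.
have sumE (i : I) (pr : R) : (forall u, prob R (B i v u) = pr) ->
    \sum_(u in nbhd e v) prob R (B i v u) = pr * d.
  move=> Hpr; rewrite (eq_bigr _ (fun u _ => Hpr u)) sumr_const -[LHS]mulr_natr.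
  by [].
have thrE c : (c <= K)%N -> #|thr c|%:R / K%:R = 1 - c%:R / K%:R :> R.
  by move=> cK; rewrite card_ord_geq natrB // mulrBl divff.
have TTE : #|[set: 'I_q]|%:R / q%:R = 1 :> R by rewrite cardsT card_ord divff.
have TKE : #|[set: 'I_K]|%:R / K%:R = 1 :> R by rewrite cardsT card_ord divff.
have hitsE (i : I) (Q : pred V) :
    (forall u, (f u \in B i v u) = Q u) ->
    hits (nbhd e v) (B i v) f = #|[set u in nbhd e v | Q u]|.
  by move=> HQ; apply: eq_card => u; rewrite !inE HQ.
split; split.
- move=> c cK; have cK' : (c < K.+1)%N by [].
  have := Hf v (inl (inl (inl (Ordinal cK', None)))).
  rewrite (sumE _ (1 - c%:R / K%:R)); last first.
    by move=> u; rewrite /B prob_rect // thrE // TTE !mulr1.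
  by rewrite (hitsE _ (fun u => c <= (f u).1.1)%N) // => u; rewrite !inE !andbT.
- move=> c y0 cK; have cK' : (c < K.+1)%N by [].
  have := Hf v (inl (inl (inl (Ordinal cK', Some y0)))).
  rewrite (sumE _ ((1 - c%:R / K%:R) / q%:R ^+ 2)); last first.
    by move=> u; rewrite /B prob_rect // -(thrE c cK) !cards1; field; rewrite K0 q0.
  by rewrite (hitsE _ (fun u => [&& c <= (f u).1.1, (f u).1.2 == y0 &
     u \in [set v | (f v).2 == z0]])%N) // => u; rewrite !inE /= andbA.
- have := Hf v (inl (inl (inr None))).
  rewrite (sumE _ (q%:R^-1)) 1?mulrC; last first.
    by move=> u; rewrite /B prob_rect // TKE TTE !cards1 !mul1r.
  by rewrite (hitsE _ (fun u => u \in [set v | (f v).2 == z0])) // => u; rewrite !inE.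
- move=> y0; have := Hf v (inl (inl (inr (Some y0)))).
  rewrite (sumE _ (q%:R^-1)) 1?mulrC; last first.
    by move=> u; rewrite /B prob_rect // TKE TTE !cards1 !mul1r mulr1.
  by rewrite (hitsE _ (fun u => (f u).1.2 == y0)) // => u; rewrite !inE /= andbT.
- move=> b; have := Hf v (inl (inr b)).
  rewrite (sumE _ ((2 * q%:R)^-1)) 1?mulrC; last first.
    move=> u; rewrite /B prob_rect // TKE !cards1 card_ord_odd mul1r.
    have h0 : (h%:R : R) != 0 by rewrite pnatr_eq0 -lt0n.
    by rewrite -muln2 natrM; field.
  rewrite (hitsE _ (fun u => (u \in [set v | (f v).2 == z0]) && (odd (f u).1.2 ==
    (if (r u < r v)%N then b else ~~ b)))) // => u; rewrite !inE /=.
  by rewrite andbC.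
- move=> a aD; have aD' : (a < (3 * Delta).+1)%N by [].
  have := Hf v (inr (inl (Ordinal aD'))).
  rewrite (hitsE _ (fun u => win1 a v u (f u).1.1)); last by move=> u; rewrite !inE !andbT.
  rewrite (eq_bigr (fun u => #|[set i | win1 a v u i]|%:R / K%:R)); last first.
    by move=> u _; rewrite /B prob_rect // TTE !mulr1.
  by rewrite ler_norml => /andP [_]; rewrite lerBlDl.
- move=> a aD; have aD' : (a < (3 * Delta).+1)%N by [].
  have := Hf v (inr (inr (Ordinal aD'))).
  rewrite (hitsE _ (fun u => (u \in [set v | (f v).2 == z0]) && win2 a v u (f u).1.1));
    last by move=> u; rewrite !inE andbT andbC.
  rewrite (eq_bigr (fun u => #|[set i | win2 a v u i]|%:R / K%:R / q%:R)); last first.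
    by move=> u _; rewrite /B prob_rect // TTE cards1 mulr1 mul1r.
  by rewrite ler_norml => /andP [_]; rewrite lerBlDl.
Qed.

End Labels.

(** * Cells, residues and windows *)

Section Cells.
Variable p : nat.

(** Cells are aligned dyadic blocks of length about a / 2^p near a; since they
    partition the integers, two equal final sums come from the same cell. *)
Definition cell_len (a : nat) : nat := (2 ^ (trunc_log 2 a - p))%N.
Definition cell_start (a : nat) : nat := (a %/ cell_len a * cell_len a)%N.
Definition cell (a : nat) : nat * nat := (cell_len a, (a %/ cell_len a)%N).

Lemma cell_len_gt0 a : (0 < cell_len a)%N.
Proof. by rewrite expn_gt0. Qed.

Lemma cell_len_bounds a : (2 ^ p <= a)%N ->
  (cell_len a * 2 ^ p <= a < cell_len a * 2 ^ p.+1)%N.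
Proof.
move=> pa; have a0 : (0 < a)%N by apply: leq_trans pa; rewrite expn_gt0.
have lep : (p <= trunc_log 2 a)%N by apply: trunc_log_max.
rewrite /cell_len -!expnD subnK // addnS subnK //.
by rewrite trunc_logP // trunc_log_ltn.
Qed.

Lemma mem_cell a t : cell t = cell a ->
  (cell_start a <= t < cell_start a + cell_len a)%N.
Proof.
rewrite /cell_start => -[lenE divE]; rewrite -lenE in divE *; rewrite -divE.
by rewrite leq_divM -mulSnr ltn_ceil ?cell_len_gt0.
Qed.

Lemma cell_eq a t : (2 ^ p <= a)%N ->
  (cell_start a <= t < cell_start a + cell_len a)%N -> cell t = cell a.
Proof.
move=> pa; have L0 := cell_len_gt0 a; have /andP [lo hi] := cell_len_bounds pa.
have a0 : (0 < a)%N by apply: leq_trans pa; rewrite expn_gt0.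
have lep : (p <= trunc_log 2 a)%N by apply: trunc_log_max.
rewrite /cell_start -mulSnr => /andP [t1 t2].
have dE : (t %/ cell_len a = a %/ cell_len a)%N.
  apply/eqP; rewrite eqn_leq -ltnS ltn_divLR // t2 /=.
  by rewrite leq_divRL.
have tE : trunc_log 2 t = trunc_log 2 a.
  apply: trunc_log_eq => //.
  have E : (2 ^ trunc_log 2 a = 2 ^ p * cell_len a)%N.
    by rewrite /cell_len -expnD subnKC.
  rewrite expnS E mulnA; apply/andP; split.
    by apply: leq_trans t1; rewrite leq_mul2r leq_divRL // mulnC lo orbT.
  apply: leq_trans t2 _; rewrite leq_mul2r ltn_divLR //.
  by rewrite -expnS mulnC hi orbT.
by rewrite /cell /cell_len tE -/(cell_len a) dE.
Qed.

End Cells.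

Lemma count_mod6 m k : count (fun t => t %% 6 < 4)%N (iota m (6 * k)) = (4 * k)%N.
Proof.
elim: k m => [|k IHk] m; first by rewrite !muln0.
rewrite (_ : 6 * k.+1 = 6 + 6 * k)%N; last by lia.
rewrite iotaD count_cat IHk; suff -> : count (fun t => t %% 6 < 4)%N (iota m 6) = 4 by lia.
rewrite (divn_eq m 6); have := ltn_pmod m (isT : 0 < 6)%N.
case: (m %% 6)%N => [|[|[|[|[|[|//]]]]]] _; rewrite /= -?addnS !modnMDl;
  by rewrite ?addn0 ?modnMl.
Qed.

Lemma count_mod6_ge m n : (4 * n <= 6 * count (fun t => t %% 6 < 4)%N (iota m n) + 20)%N.
Proof.
have nE := divn_eq n 6; have r6 := ltn_pmod n (isT : 0 < 6)%N.
rewrite [X in iota _ X]nE (mulnC _ 6) iotaD count_cat count_mod6; lia.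
Qed.

(** Positions whose image under an affine map lies in an interval: the least and
    the greatest of them are at most (hi - lo) / beta apart. *)
Lemma window_card (R : realType) (K : nat) (alpha beta lo hi : R) (P : pred 'I_K) :
  0 < beta -> lo <= hi ->
  (forall i, P i -> lo <= alpha + beta * i%:R <= hi) ->
  #|[set i | P i]|%:R <= (hi - lo) / beta + 1.
Proof.
move=> b0 lohi HP; set S := [set i | P i].
case: (set_0Vmem S) => [->|[j jS]].
  by rewrite cards0 addr_ge0 // divr_ge0 ?subr_ge0 // ltW.
pose i0 := [arg min_(i < j in S) (i : nat)]; pose i1 := [arg max_(i > j in S) (i : nat)].
have [i0S i0min] : i0 \in S /\ forall i, i \in S -> (i0 <= i)%N.
  by rewrite /i0; case: arg_minnP.
have [i1S i1max] : i1 \in S /\ forall i, i \in S -> (i <= i1)%N.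
  by rewrite /i1; case: arg_maxnP.
have le01 : (i0 <= i1)%N by apply: i0min.
have : (#|S| <= (i1 - i0).+1)%N.
  rewrite cardE -(size_map val) -(size_iota i0 (i1 - i0).+1).
  apply: uniq_leq_size; first by rewrite map_inj_uniq ?enum_uniq //; apply: val_inj.
  move=> k /mapP [i]; rewrite mem_enum => iS ->; rewrite mem_iota.
  by have := i0min i iS; have := i1max i iS; rewrite /=; lia.
rewrite -(ler_nat R) -addn1 natrD natrB // => /le_trans; apply.
rewrite lerD2r ler_pdivlMr //.
have := HP i0; have := HP i1; rewrite !inE in i0S i1S.
by move=> /(_ i1S) /andP [_ h1] /(_ i0S) /andP [h0 _]; lra.
Qed.

(** * Estimates for a typical labelling *)

Lemma sum_card (T : finType) (A : {set T}) (Q : pred T) :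
  (\sum_(u in A) Q u = #|[set u in A | Q u]|)%N.
Proof.
rewrite -sum1dep_card [RHS]big_mkcondr /=; apply: eq_bigr => u _.
by case: (Q u).
Qed.

Section Application.
Variables (R : realType) (K q p : nat) (V : finType) (e : rel V).
Variables (x : V -> 'I_K) (y : V -> 'I_q) (W : {set V}).
Hypotheses (e_sym : symmetric e) (e_irr : irreflexive e).

Definition tunable : rel V :=
  [rel u v | [&& e u v, (u \in W) != (v \in W) & y u == y v]].

Definition base_weight (u v : V) : nat :=
  if tunable u v || inner e W u v then 2 else if (K <= x u + x v)%N then 3 else 1.

Definition rank (v : V) : nat := enum_rank v.
(** Decreasing degree, ties broken arbitrarily. *)
Definition degree_rank (v : V) : nat := ((#|V| - #|nbhd e v|) * #|V| + enum_rank v)%N.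

Local Notation qR := (q%:R : R).
(** The probability that a given edge at a vertex outside [W] is tunable. *)
Definition tuning_density : R := (q%:R ^+ 2)^-1.
Local Notation sigma := tuning_density.
Local Notation eps := (sigma / 4096).
Local Notation d v := (#|nbhd e v|%:R : R).
Local Notation s0 := (weight_sum e base_weight).

(** The mean of the starting sum of a vertex outside [W] at position [i].  The
    correction by the tunable edges must be exact here, because the cells are
    shorter than the number of these edges. *)
Definition outer_mean (u : V) (i : nat) : R :=
  d u * (1 + sigma + 2 * (1 - sigma) * (i%:R / K%:R)).

(** The positions at which [u], of degree at least that of [v], may start in the
    cell of [a]. *)
Definition same_cell_window (a : nat) (v u : V) : pred 'I_K := fun i =>
  (d v <= d u) &&
  ((cell_start p a)%:R - 5 * eps * d u <= outer_mean u i <=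
   (cell_start p a)%:R + (cell_len p a)%:R + 5 * eps * d u).

(** The positions at which [u] in [W] may get close to a sum [a] at [v]; the
    deviations from the mean and all later moves stay below 6/q times the degrees. *)
Definition near_window (a : nat) (v u : V) : pred 'I_K := fun i =>
  (d v <= 4 * d u) &&
  (`|d u * (1 + 2 * (i%:R / K%:R)) - a%:R| <= 6 / qR * (d u + d v)).

Hypotheses (K_gt0 : (0 < K)%N) (q_large : 1024 <= qR).
Hypothesis K_large : K%:R^-1 = sigma / 1024.
Hypothesis p_eq : (2 ^ p)%:R * sigma = 4 :> R.
Hypothesis d_large : forall v, 1000 <= sigma * d v.

Variable Delta : nat.

Record typical : Prop := Typical {
  le_Delta : forall v, (#|nbhd e v| <= Delta)%N;
  thr_count : forall v c, (c <= K)%N ->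
    `|#|[set u in nbhd e v | (c <= x u)%N]|%:R - (1 - c%:R / K%:R) * d v| <= eps * d v;
  thr_tunable_count : forall v c y0, (c <= K)%N ->
    `|#|[set u in nbhd e v | [&& (c <= x u)%N, y u == y0 & u \in W]]|%:R
      - (1 - c%:R / K%:R) * sigma * d v| <= eps * d v;
  W_count : forall v,
    `|#|[set u in nbhd e v | u \in W]|%:R - d v / qR| <= eps * d v;
  class_count : forall v y0,
    `|#|[set u in nbhd e v | y u == y0]|%:R - d v / qR| <= eps * d v;
  owned_count : forall v (b : bool),
    `|#|[set u in nbhd e v | (u \in W) &
          (odd (y u) == (if (rank u < rank v)%N then b else ~~ b))]|%:R
      - d v / (2 * qR)| <= eps * d v;
  cell_count : forall v a, (a <= 3 * Delta)%N ->
    #|[set u in nbhd e v | same_cell_window a v u (x u)]|%:R <=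
    \sum_(u in nbhd e v) #|[set i | same_cell_window a v u i]|%:R / K%:R + eps * d v;
  near_count : forall v a, (a <= 3 * Delta)%N ->
    #|[set u in nbhd e v | (u \in W) && near_window a v u (x u)]|%:R <=
    \sum_(u in nbhd e v) #|[set i | near_window a v u i]|%:R / K%:R / qR + eps * d v }.

Hypothesis typ : typical.

Lemma tunable_sym : symmetric tunable.
Proof. by move=> u v; rewrite /tunable /= e_sym eq_sym (eq_sym (y u)). Qed.

Lemma nbhd_sub (e1 : rel V) v : subrel e1 e ->
  nbhd e1 v = [set u in nbhd e v | e1 v u].
Proof.
by move=> sub; apply/setP => u; rewrite !inE; case: (boolP (e1 v u)) => [/sub ->|]; rewrite ?andbF.
Qed.

Lemma tunable_sub : subrel tunable e.
Proof. by move=> u v /and3P []. Qed.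

Lemma inner_sub : subrel (inner e W) e.
Proof. by move=> u v /and3P []. Qed.

Lemma base_weight_sym u v : base_weight u v = base_weight v u.
Proof.
by rewrite /base_weight tunable_sym addnC /inner /= e_sym (andbC (u \in W)).
Qed.

(** The hierarchy sigma d << d / q << d of the error terms; with these bounds the
    estimates below are linear. *)
Lemma scale v : [/\ 1000 <= sigma * d v, 1024 * (sigma * d v) <= d v / qR,
  1024 * (d v / qR) <= d v & sigma <= 1000^-1 /\ 0 < sigma].
Proof.
have q1 := q_large; have q0 : 0 < qR by lra.
have s0' : 0 < sigma by rewrite invr_gt0 exprn_gt0.
have qi : qR^-1 <= 1024^-1 by rewrite lef_pV2 ?posrE //; lra.
have qi0 : 0 < qR^-1 by rewrite invr_gt0.
have sE : sigma = qR^-1 * qR^-1 by rewrite /tuning_density -exprVn expr2.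
have d0 : 0 <= d v by [].
split.
- exact: d_large.
- have -> : sigma * d v = qR^-1 * (d v / qR) by rewrite sE; ring.
  have t0 : 0 <= d v / qR by rewrite divr_ge0 // ltW.
  have := ler_wpM2r t0 qi; lra.
- have := ler_wpM2l d0 qi; lra.
- split => //; rewrite sE.
  have : qR^-1 * qR^-1 <= 1024^-1 * 1 by apply: ler_pM; lra.
  lra.
Qed.

Lemma card_tunable_le v : (#|nbhd tunable v| <=
  #|[set u in nbhd e v | y u == y v]|)%N.
Proof.
apply: subset_leq_card; apply/subsetP => u; rewrite !inE /= => /and3P [-> _].
by rewrite eq_sym.
Qed.

Lemma card_inner_le v : (#|nbhd (inner e W) v| <= #|[set u in nbhd e v | u \in W]|)%N.
Proof.
by apply: subset_leq_card; apply/subsetP => u; rewrite !inE /= => /and3P [-> _ ->].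
Qed.

Lemma card_tunable v : v \notin W ->
  `|#|nbhd tunable v|%:R - sigma * d v| <= eps * d v.
Proof.
move=> vW; have := thr_tunable_count typ v (y v) (leq0n K).
rewrite mul0r subr0 mul1r.
suff -> : nbhd tunable v = [set u in nbhd e v | [&& (0 <= x u)%N, y u == y v & u \in W]] by [].
apply/setP => u; rewrite !inE /tunable /= (negbTE vW) (eq_sym (y v)).
by case: (u \in W); case: (y u == y v).
Qed.

Lemma outer_sum v : v \notin W -> `|(s0 v)%:R - outer_mean v (x v)| <= 5 * eps * d v.
Proof.
move=> vW; pose c := (K - x v)%N; have cK : (c <= K)%N by apply: leq_subr.
have xK := ltn_ord (x v).
have E : (s0 v + (#|[set u in nbhd e v | [&& (c <= x u)%N, y u == y v & u \in W]]| +
      #|[set u in nbhd e v | [&& (c <= x u)%N, y u == y v & u \in W]]|) =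
    #|nbhd e v| + (#|[set u in nbhd e v | (c <= x u)%N]| +
      #|[set u in nbhd e v | (c <= x u)%N]|) + #|nbhd tunable v|)%N.
  rewrite (nbhd_sub _ tunable_sub).
  rewrite -!sum_card -[#|nbhd e v|]sum1_card /weight_sum -!big_split /=.
  apply: eq_bigr => u; rewrite inE => evu.
  rewrite /base_weight /tunable /inner /= evu (negbTE vW) (eq_sym (y v)) /=.
  have -> : (K <= x v + x u)%N = (c <= x u)%N by rewrite leq_subLR.
  by case: (c <= x u)%N; case: (y u == y v); case: (u \in W).
move/(congr1 (GRing.natmul (1 : R))): E; rewrite !natrD => E.
have h1 := thr_count typ v cK; have h2 := thr_tunable_count typ v (y v) cK.
have h3 := card_tunable vW.
have cE : 1 - c%:R / K%:R = (x v)%:R / K%:R :> R.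
  by rewrite /c natrB; [field; rewrite pnatr_eq0 -lt0n | exact: ltnW].
move: h1 h2 h3; rewrite cE /outer_mean !ler_norml => /andP [h1 h1'] /andP [h2 h2'] /andP [h3 h3'].
set X := (x v)%:R / K%:R in h1 h1' h2 h2' *.
have -> : d v * (1 + sigma + 2 * (1 - sigma) * X) =
  d v + sigma * d v + 2 * (X * d v) - 2 * (X * sigma * d v) by ring.
move: E h1 h1' h2 h2' h3 h3'; clear; move: X => X.
by move=> *; apply/andP; split; lra.
Qed.

Lemma base_sum_bounds v :
  (#|nbhd e v| + #|nbhd tunable v| <= s0 v)%N /\
  (s0 v + #|nbhd tunable v| <= 3 * #|nbhd e v|)%N.
Proof.
rewrite (nbhd_sub _ tunable_sub).
rewrite -!sum_card -[#|nbhd e v|]sum1_card /weight_sum big_distrr /= -!big_split /=.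
split; apply: leq_sum => u _; rewrite /base_weight;
  by case: (tunable v u) => //=; case: ifP => // _; case: ifP.
Qed.

Lemma cell_bounds v : let L : R := (cell_len p (s0 v))%:R in
  [/\ (2 ^ p <= s0 v)%N, L <= 3 / 4 * (sigma * d v) & sigma * d v <= 8 * L].
Proof.
move=> L; have [lo hi] := base_sum_bounds v; have [s1 _ _ [_ sg0]] := scale v.
have ps : (2 ^ p <= s0 v)%N.
  apply: leq_trans (leq_trans (leq_addr _ _) lo).
  rewrite -(ler_nat R) -(ler_pM2r sg0) p_eq mulrC; lra.
have /andP [l1 l2] := cell_len_bounds ps.
have s3 : (s0 v)%:R <= 3 * d v.
  by rewrite -natrM ler_nat; apply: leq_trans hi; apply: leq_addr.
have sd : d v <= (s0 v)%:R.
  by rewrite ler_nat; apply: leq_trans lo; apply: leq_addr.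
split => //.
  have := l1; rewrite -(ler_nat R) natrM -(ler_pM2r sg0) -mulrA p_eq -/L => h1.
  have := s3; rewrite -(ler_pM2r sg0); lra.
have := ltnW l2; rewrite expnS mulnCA -(ler_nat R) natrM natrM -(ler_pM2r sg0).
rewrite -!mulrA p_eq -/L => h1.
have := sd; rewrite -(ler_pM2r sg0); lra.
Qed.

Lemma outer_reach v : v \notin W -> (cell_len p (s0 v) <= #|nbhd tunable v|)%N.
Proof.
move=> vW; have [_ L1 _] := cell_bounds v; have [s1 _ _ [_ sg0]] := scale v.
rewrite -(ler_nat R); have := card_tunable vW; rewrite ler_norml => /andP [h _].
lra.
Qed.

(** Here the order by degree is used: [u] has density about 1 / (2 d u), which is
    at most 1 / (2 d v).  The constant 501/1000 is one half with room for the
    factor 1 / (1 - sigma). *)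
Lemma same_cell_window_card a v u :
  #|[set i | same_cell_window a v u i]|%:R / K%:R <=
  501 / 1000 * ((cell_len p a)%:R / d v + 10 * eps) + sigma / 1024.
Proof.
have [s1 _ _ [sg1 sg0]] := scale u; have [sv1 _ _ _] := scale v.
have dv0 : 0 < d v by rewrite -(pmulr_rgt0 _ sg0); lra.
have du0 : 0 < d u by rewrite -(pmulr_rgt0 _ sg0); lra.
have K0 : 0 < K%:R :> R by rewrite ltr0n.
set L : R := (cell_len p a)%:R.
have Ld : 0 <= L / d v by rewrite divr_ge0.
case: (lerP (d v) (d u)) => dvu; last first.
  rewrite (_ : [set i | _] = set0); first by rewrite cards0 mul0r; lra.
  by apply/setP => i; rewrite !inE /same_cell_window leNgt dvu.
have [sg1' one] : 0 < 1 - sigma /\ 1 / (2 * (1 - sigma)) <= 501 / 1000.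
  by split; [lra | rewrite ler_pdivrMr; lra].
have b0 : 0 < d u * (2 * (1 - sigma)) / K%:R by rewrite divr_gt0 // !mulr_gt0.
set lo : R := (cell_start p a)%:R - 5 * eps * d u.
set hi : R := (cell_start p a)%:R + L + 5 * eps * d u.
have L0 : 0 <= L by [].
have ed : 0 < sigma * d u by rewrite mulr_gt0.
have lohi : lo <= hi by rewrite /lo /hi; lra.
have Hwin (i : 'I_K) : same_cell_window a v u i ->
    lo <= d u * (1 + sigma) + d u * (2 * (1 - sigma)) / K%:R * i%:R <= hi.
  move=> /andP [_]; rewrite -/lo -/hi.
  have -> : d u * (1 + sigma) + d u * (2 * (1 - sigma)) / K%:R * i%:R = outer_mean u i.
    by rewrite /outer_mean; ring.
  by [].
have Ki0 : 0 <= K%:R^-1 :> R by rewrite invr_ge0.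
have H := ler_wpM2r Ki0 (window_card b0 lohi Hwin).
apply: le_trans H _.
have -> : ((hi - lo) / (d u * (2 * (1 - sigma)) / K%:R) + 1) / K%:R =
    (L / d u + 10 * eps) * (1 / (2 * (1 - sigma))) + K%:R^-1.
  have alg (c l E D S k : R) : D != 0 -> S != 0 -> k != 0 ->
      ((c + l + 5 * E * D - (c - 5 * E * D)) / (D * (2 * S) / k) + 1) / k =
      (l / D + 10 * E) * (1 / (2 * S)) + k^-1.
    by move=> D0 S0 k0; field; rewrite D0 S0 k0.
  by rewrite /hi /lo alg // lt0r_neq0.
rewrite K_large lerD2r mulrC; apply: ler_pM => //.
- by rewrite divr_ge0 // ltW // mulr_gt0.
- by rewrite addr_ge0 // ?divr_ge0 // mulr_ge0 // divr_ge0 // ltW.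
- by rewrite lerD2r ler_wpM2l // lef_pV2.
Qed.

Lemma degree_rank_inj : injective degree_rank.
Proof.
move=> u v E; apply: enum_rank_inj; apply: val_inj.
have := congr1 (fun k => k %% #|V|)%N E; rewrite /degree_rank !modnMDl.
by rewrite !modn_small.
Qed.

Lemma degree_rank_le u v : (degree_rank u < degree_rank v)%N ->
  (#|nbhd e v| <= #|nbhd e u|)%N.
Proof.
move=> ruv; rewrite leqNgt; apply/negP => uv; move: ruv; rewrite ltnNge => /negP; apply.
have vV : (#|nbhd e v| <= #|V|)%N by exact: max_card.
have rv : (enum_rank v < #|V|)%N by exact: ltn_ord.
rewrite /degree_rank.
have lt1 : ((#|V| - #|nbhd e v|).+1 <= #|V| - #|nbhd e u|)%N by lia.
have := leq_mul lt1 (leqnn #|V|); rewrite mulSn.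
lia.
Qed.

Definition outer_values (v : V) : seq nat :=
  [seq t <- iota (cell_start p (s0 v)) (cell_len p (s0 v)) | (t %% 6 < 4)%N].

Lemma mem_s0_cell v : (cell_start p (s0 v) <= s0 v < cell_start p (s0 v) + cell_len p (s0 v))%N.
Proof. exact: mem_cell. Qed.

(** Slightly more than half of the cell is taken, and about two thirds of it has
    an admissible residue. *)
Lemma outer_values_large v : v \notin W ->
  (#|[set u | [&& e v u, u \notin W, cell p (s0 u) == cell p (s0 v) &
      (degree_rank u < degree_rank v)%N]]| < size (outer_values v))%N.
Proof.
move=> vW; set Bl := [set u | _].
have [ps L1 L2] := cell_bounds v; have [s1 s2 s3 [_ sg0]] := scale v.
have dv0 : 0 < d v by rewrite -(pmulr_rgt0 _ sg0); lra.
set L : R := (cell_len p (s0 v))%:R in L1 L2.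
have sub : Bl \subset [set u in nbhd e v | same_cell_window (s0 v) v u (x u)].
  apply/subsetP => u; rewrite !inE => /and4P [-> uW /eqP cE /degree_rank_le dvu] /=.
  rewrite /same_cell_window ler_nat dvu /=.
  have := outer_sum uW; have := mem_cell cE.
  rewrite -(ler_nat R) => /andP [h1 /ltnW]; rewrite -(ler_nat R) natrD => h2.
  by rewrite ler_norml => /andP [h3 h4]; apply/andP; split; lra.
have aD : (s0 v <= 3 * Delta)%N.
  have [_ hi] := base_sum_bounds v; apply: leq_trans (leq_trans (leq_addr _ _) hi) _.
  by rewrite leq_mul2l (le_Delta typ) orbT.
have B1 : #|Bl|%:R <= 501 / 1000 * (L + 10 * (eps * d v)) + sigma * d v / 1024 + eps * d v.
  apply: (le_trans (y := #|[set u in nbhd e v | same_cell_window (s0 v) v u (x u)]|%:R)).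
    by rewrite ler_nat subset_leq_card.
  apply: le_trans (cell_count typ v aD) _; rewrite lerD2r.
  apply: (le_trans (y := \sum_(u in nbhd e v)
     (501 / 1000 * (L / d v + 10 * eps) + sigma / 1024))).
    by apply: ler_sum => u _; apply: same_cell_window_card.
  rewrite sumr_const -[leLHS]mulr_natr.
  have alg (l E D S : R) : D != 0 -> (501 / 1000 * (l / D + 10 * E) + S / 1024) * D =
      501 / 1000 * (l + 10 * (E * D)) + S * D / 1024 by move=> D0; field.
  by rewrite alg // lt0r_neq0.
have := count_mod6_ge (cell_start p (s0 v)) (cell_len p (s0 v)).
rewrite -size_filter -/(outer_values v) -(ler_nat R) natrM natrD natrM -/L => h.
rewrite -(ltr_nat R); lra.
Qed.

(** Membership in [W] contributes one factor 1/q and the length of the window the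
    other one. *)
Lemma near_window_card a v u :
  #|[set i | near_window a v u i]|%:R / K%:R / qR <= 31 * sigma.
Proof.
have [s1 _ _ [sg1 sg0]] := scale u; have [sv1 _ _ _] := scale v.
have dv0 : 0 < d v by rewrite -(pmulr_rgt0 _ sg0); lra.
have du0 : 0 < d u by rewrite -(pmulr_rgt0 _ sg0); lra.
have K0 : 0 < K%:R :> R by rewrite ltr0n.
have q1 := q_large; have q0 : 0 < qR by lra.
have qi0 : 0 < qR^-1 by rewrite invr_gt0.
have sE : sigma = qR^-1 * qR^-1 by rewrite /tuning_density -exprVn expr2.
case: (lerP (d v) (4 * d u)) => dvu; last first.
  rewrite (_ : [set i | _] = set0); first by rewrite cards0 !mul0r; lra.
  by apply/setP => i; rewrite !inE /near_window leNgt dvu.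
have b0 : 0 < d u * 2 / K%:R by rewrite divr_gt0 // !mulr_gt0.
set w : R := 6 / qR * (d u + d v).
have w0 : 0 <= w by rewrite mulr_ge0 // ?divr_ge0 // ?ltW //; lra.
have lohi : a%:R - w <= a%:R + w by lra.
have Hwin (i : 'I_K) : near_window a v u i ->
    a%:R - w <= d u + d u * 2 / K%:R * i%:R <= a%:R + w.
  move=> /andP [_]; rewrite -/w ler_norml => /andP [h1 h2].
  have -> : d u + d u * 2 / K%:R * i%:R = d u * (1 + 2 * (i%:R / K%:R)) by ring.
  by apply/andP; split; lra.
have Kq0 : 0 <= K%:R^-1 * qR^-1 by rewrite mulr_ge0 // invr_ge0 // ltW.
have H := ler_wpM2r Kq0 (window_card b0 lohi Hwin).
rewrite -mulrA; apply: le_trans H _.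
have -> : ((a%:R + w - (a%:R - w)) / (d u * 2 / K%:R) + 1) * (K%:R^-1 * qR^-1) =
    6 * sigma * (1 + d v / d u) + K%:R^-1 * qR^-1.
  by rewrite sE /w; field; rewrite !lt0r_neq0.
rewrite K_large.
have r4 : d v / d u <= 4 by rewrite ler_pdivrMr.
have := ler_wpM2l (ltW sg0) r4.
have qi : qR^-1 <= 1 by rewrite invf_le1 //; lra.
have := ler_wpM2l (ltW sg0) qi.
have -> : 6 * sigma * (1 + d v / d u) = 6 * sigma + 6 * (sigma * (d v / d u)) by ring.
have -> : sigma / 1024 * qR^-1 = sigma * qR^-1 / 1024 by ring.
lra.
Qed.

(** In [W] a crude estimate suffices: the tunable and the inner edges together are
    a fraction O(1/q) of the edges. *)
Lemma inner_sum (s1 : V -> int) v :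
  (forall v, `|s1 v - (s0 v)%:Z| <= #|nbhd tunable v|%:Z) -> v \in W ->
  `|(s1 v)%:~R - d v * (1 + 2 * ((x v)%:R / K%:R))| <= 4 * (d v / qR).
Proof.
move=> s1_near vW; pose c := (K - x v)%N; have cK : (c <= K)%N by apply: leq_subr.
have xK := ltn_ord (x v).
have [t1 t2 t3 _] := scale v.
pose th := #|[set u in nbhd e v | (c <= x u)%N]|.
have [E1 E2] : (s0 v <= #|nbhd e v| + (th + th) + #|nbhd tunable v| + #|nbhd (inner e W) v|)%N /\
    (#|nbhd e v| + (th + th) <= s0 v + #|nbhd tunable v| + #|nbhd (inner e W) v|)%N.
  rewrite (nbhd_sub _ tunable_sub) (nbhd_sub _ inner_sub).
  rewrite /th -!sum_card -[#|nbhd e v|]sum1_card /weight_sum -!big_split /=.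
  split; apply: leq_sum => u _; rewrite /base_weight;
  have -> : (K <= x v + x u)%N = (c <= x u)%N by rewrite leq_subLR.
    by case: (tunable v u); case: (inner e W v u); case: (c <= x u)%N.
  by case: (tunable v u); case: (inner e W v u); case: (c <= x u)%N.
have := s1_near v; have := card_tunable_le v; have := card_inner_le v.
move: E1 E2; rewrite -!(ler_nat R) !natrD => E1 E2 ci ct sn.
have sn' : `|(s1 v)%:~R - (s0 v)%:R| <= #|nbhd tunable v|%:R :> R.
  by have := sn; rewrite -(ler_int R) intr_norm rmorphB.
have h1 := thr_count typ v cK; have h2 := W_count typ v; have h3 := class_count typ v (y v).
have cE : 1 - c%:R / K%:R = (x v)%:R / K%:R :> R.
  by rewrite /c natrB; [field; rewrite pnatr_eq0 -lt0n | exact: ltnW].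
move: h1 h2 h3 sn'; rewrite cE -/th !ler_norml.
move=> /andP [h1 h1'] /andP [h2 h2'] /andP [h3 h3'] /andP [h4 h4'].
set X := (x v)%:R / K%:R in h1 h1' *.
have -> : d v * (1 + 2 * X) = d v + 2 * (X * d v) by ring.
move: E1 E2 ci ct h1 h1' h2' h3' h4 h4' t1 t2 t3; clear; move: (X * d v) => Xd.
by move=> *; apply/andP; split; lra.
Qed.

(** About 31 sigma d = 31 d / q^2 possible conflicts against d / (2q) owned edges,
    and 6 * 31 < q / 2. *)
Lemma inner_rich (s1 : V -> int) :
  (forall v, `|s1 v - (s0 v)%:Z| <= #|nbhd tunable v|%:Z) ->
  forall v, v \in W ->
  (6 * (#|[set u | inner e W v u & (`|(s1 u - s1 v)%R| <=
             1 + #|nbhd (inner e W) u| + #|nbhd (inner e W) v|)%N]| + 1)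
   <= #|usable (inner e W) rank (fun v => odd (y v)) v|)%N.
Proof.
move=> s1_near v vW; set Bl := [set u | _].
have [t1 t2 t3 [_ sg0]] := scale v.
have s1_bounds u : (#|nbhd e u|%:Z <= s1 u <= (3 * #|nbhd e u|)%N%:Z).
  have arith (n t s : nat) (z : int) : (n + t <= s)%N -> (s + t <= 3 * n)%N ->
    `|z - s%:Z| <= t%:Z -> n%:Z <= z <= (3 * n)%N%:Z by clear; lia.
  by have [lo hi] := base_sum_bounds u; apply: arith lo hi (s1_near u).
have sR u : (`|s1 u|%N%:R : R) = (s1 u)%:~R.
  have s1u0 : 0 <= s1 u by have /andP [+ _] := s1_bounds u; apply: le_trans.
  by rewrite -[in RHS](gez0_abs s1u0).
have sub : Bl \subset [set u in nbhd e v | (u \in W) && near_window `|s1 v|%N v u (x u)].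
  apply/subsetP => u; rewrite !inE /= => /andP [/and3P [-> _ uW] near]; rewrite uW /=.
  have [u1 u2 u3 _] := scale u.
  have pu := inner_sum s1_near uW.
  have iu := card_inner_le u; have iv := card_inner_le v.
  have wu := W_count typ u; have wv := W_count typ v.
  have {}near : `|(s1 u)%:~R - (s1 v)%:~R| <=
      1 + #|nbhd (inner e W) u|%:R + #|nbhd (inner e W) v|%:R :> R.
    rewrite -rmorphB -intr_norm -abszE -pmulrn.
    by move: near; rewrite -(ler_nat R) !natrD.
  have : (s1 u)%:~R <= 3 * d u :> R /\ d v <= (s1 v)%:~R :> R.
    have /andP [_] := s1_bounds u; have /andP [+ _] := s1_bounds v.
    by rewrite -!(ler_int R) => h1 h2; split; rewrite // -natrM.
  case=> su sv; rewrite /near_window sR.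
  move: iu iv; rewrite -!(ler_nat R) => iu iv.
  move: pu wu wv near; rewrite !ler_norml.
  move=> /andP [p1 p2] /andP [_ w1] /andP [_ w2] /andP [n1 n2].
  have -> : 6 / qR * (d u + d v) = 6 * (d u / qR) + 6 * (d v / qR) by ring.
  move: p1 p2 w1 w2 n1 n2 su sv iu iv t1 t2 t3 u1 u2 u3; clear.
  by move=> *; apply/andP; split; [lra | apply/andP; split; lra].
have aD : (`|s1 v|%N <= 3 * Delta)%N.
  by have := s1_bounds v; have := le_Delta typ v; clear; lia.
have B1 : #|Bl|%:R <= 31 * (sigma * d v) + eps * d v.
  apply: (le_trans (y := #|[set u in nbhd e v | (u \in W) && near_window `|s1 v|%N v u (x u)]|%:R)).
    by rewrite ler_nat subset_leq_card.
  apply: le_trans (near_count typ v aD) _; rewrite lerD2r.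
  apply: (le_trans (y := \sum_(u in nbhd e v) 31 * sigma)).
    by apply: ler_sum => u _; apply: near_window_card.
  by rewrite sumr_const -[leLHS]mulr_natr mulrA.
have U1 : d v / (2 * qR) - eps * d v <=
    #|usable (inner e W) rank (fun v => odd (y v)) v|%:R.
  have := owned_count typ v (odd (y v)).
  set A := [set u in nbhd e v | _].
  have -> : A = usable (inner e W) rank (fun v => odd (y v)) v.
    apply/setP => u; rewrite !inE /inner /= vW /= -andbA; congr [&& _, _ & _].
    by case: ifP => _ //; case: (odd (y u)); case: (odd (y v)).
  by rewrite ler_norml => /andP [hh _]; move: hh; rewrite lerBrDr addrC.
rewrite -(ler_nat R) natrM natrD; apply: le_trans U1.
have q1 := q_large; have q0 : 0 < qR by lra.
have -> : d v / (2 * qR) = d v / qR / 2 by field; rewrite lt0r_neq0.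
lra.
Qed.

Theorem labelled_weighting : exists w : V -> V -> nat,
  [/\ forall u v, w u v = w v u, forall u v, e u v -> (1 <= w u v <= 3)%N &
      forall u v, e u v -> weight_sum e w u <> weight_sum e w v].
Proof.
apply: (@assembly V _ e tunable W base_weight rank degree_rank
  (fun v => odd (y v)) (cell p) outer_values) => //.
- exact: tunable_sym.
- by move=> u v /and3P [].
- by move=> u v /and3P [_]; case: (u \in W); case: (v \in W).
- exact: base_weight_sym.
- by move=> u v; rewrite /base_weight; case: ifP => // _; case: ifP.
- by move=> u v; rewrite /base_weight => ->.
- by move=> u v /val_inj /enum_rank_inj.
- exact: degree_rank_inj.
- by move=> v; rewrite filter_uniq ?iota_uniq.
- by move=> v t _; rewrite mem_filter => /andP [].
- move=> v t _; rewrite mem_filter mem_iota => /andP [_].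
  by have [ps _ _] := cell_bounds v; apply: cell_eq.
- move=> v t vW; rewrite mem_filter mem_iota => /andP [_ ht].
  by have := mem_s0_cell v; have := outer_reach vW; lia.
- exact: outer_values_large.
- exact: inner_rich.
Qed.

End Application.

(** * The theorem *)

(** q = 2^10, K = 2^30 and p = 22, known only through their values in R so that the
    large natural numbers are never unfolded. *)
Lemma parameters (R : realType) : exists h K p : nat,
  [/\ (0 < h)%N, (0 < K)%N, 1024 <= h.*2%:R :> R,
      K%:R^-1 = tuning_density R h.*2 / 1024 :> R &
      (2 ^ p)%:R * tuning_density R h.*2 = 4 :> R].
Proof.
have q_eq : ((2 ^ 9).*2)%:R = 1024 :> R.
  by rewrite -muln2 -expnSr natrX; ring.
have [K K0 K_eq] : exists2 K : nat, (0 < K)%N & K%:R = 2 ^+ 30 :> R.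
  by exists (2 ^ 30)%N; [rewrite expn_gt0 | rewrite natrX].
have [m m_eq] : exists m : nat, (2 ^ m)%:R = 2 ^+ 22 :> R.
  by exists 22; rewrite natrX.
exists (2 ^ 9)%N, K, m; rewrite /tuning_density q_eq K_eq m_eq; split => //.
- by field.
- by field.
Qed.

Lemma ln_ge_half (R : realType) (n : nat) : (1 < n)%N -> 2^-1 <= ln n%:R :> R.
Proof.
move=> n1; have : ln (1 + - 2^-1) <= - 2^-1 :> R by apply: le_ln1Dx; lra.
have -> : 1 + - 2^-1 = 2^-1 :> R by field.
rewrite lnV ?posrE // lerN2 => /le_trans; apply.
by rewrite ler_ln ?posrE ?ltr0n ?ler_nat //; lia.
Qed.

Theorem theorem2 (R : realType) :
  exists C : R, forall G : sgraph,
    (2 <= max_degree G)%N ->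
    C * ln (max_degree G)%:R <= (min_degree G)%:R ->
    exists w : {set G} -> nat, weighting 3 w /\ vertex_colouring w.
Proof.
have [h [K [p [h0 K0 q_large K_large p_eq]]]] := parameters R.
set sigma := tuning_density R h.*2 in K_large p_eq.
have q0 : 0 < h.*2%:R :> R by lra.
have sg0 : 0 < sigma by rewrite invr_gt0 exprn_gt0.
have sg1 : sigma <= 1.
  by rewrite invf_le1 ?exprn_gt0 // exprn_ege1 //; lra.
have [|C C0 HC] := @typical_labels R K h K0 h0 (sigma / 4096).
  by apply/andP; split; lra.
(* Large enough for the number of counting events to be at most Delta^2. *)
pose n0 := (K.+1 * h.*2.+1 + h.*2.+1 + 10)%N.
pose M : R := 1000 / sigma + n0%:R.
have M0 : 0 <= M by rewrite addr_ge0 // divr_ge0 // ltW.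
(* As log Delta >= 1/2, the summand 2 * M forces every degree to be at least M. *)
exists (C + 2 * M) => G D2 dle; set Delta := max_degree G in D2 dle *.
have lnD := ln_ge_half R D2.
have dM v : M <= #|nbhd (@adj G) v|%:R.
  have : (min_degree G)%:R <= #|nbhd (@adj G) v|%:R :> R by rewrite ler_nat min_degree_le.
  apply: le_trans; apply: le_trans dle.
  have h1 := ler_wpM2l M0 lnD; have h2 : 0 <= C * ln Delta%:R by rewrite mulr_ge0 //; lra.
  have -> : (C + 2 * M) * ln Delta%:R = C * ln Delta%:R + 2 * (M * ln Delta%:R) by ring.
  lra.
have dC v : C * ln Delta%:R <= #|nbhd (@adj G) v|%:R.
  have : (min_degree G)%:R <= #|nbhd (@adj G) v|%:R :> R by rewrite ler_nat min_degree_le.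
  apply: le_trans; apply: le_trans dle.
  apply: ler_wpM2r; lra.
have [v _] : exists v : G, true.
  case: (pickP (fun _ : G => true)) => [v _|no]; first by exists v.
  by move: D2; rewrite /Delta /max_degree big_pred0.
have n0D : (n0 <= Delta)%N.
  apply: leq_trans (le_max_degree v); rewrite -(ler_nat R); apply: le_trans (dM v).
  by rewrite lerDr divr_ge0 // ltW.
have big : (K.+1 * h.*2.+1 + h.*2.+1 + 2 + ((3 * Delta).+1 + (3 * Delta).+1)
    <= Delta ^ 2)%N.
  have h1 : (n0 * Delta <= Delta ^ 2)%N by rewrite expnS expn1 leq_mul2r n0D orbT.
  apply: leq_trans h1; rewrite /n0; move: (K.+1 * h.*2.+1 + h.*2.+1)%N => k.
  have h2 : (k <= k * Delta)%N by rewrite leq_pmulr // ltnW.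
  by rewrite mulnDl; clear - D2 h2; lia.
have [x [y [W HW]]] := HC G (@adj G) Delta (@rank G)
  (same_cell_window R h.*2 p (@adj G)) (near_window R h.*2 (@adj G))
  (@adj_sym G) D2 big (@le_max_degree G) dC.
have d_large u : 1000 <= sigma * #|nbhd (@adj G) u|%:R.
  rewrite mulrC -ler_pdivrMr //; apply: le_trans (dM u).
  by rewrite lerDl.
have typ : typical R p (@adj G) x y W Delta.
  split; first exact: le_max_degree.
  - by move=> u; have [[]] := HW u.
  - by move=> u; have [[]] := HW u.
  - by move=> u; have [[]] := HW u.
  - by move=> u; have [[]] := HW u.
  - by move=> u; have [_ []] := HW u.
  - by move=> u; have [_ []] := HW u.
  - by move=> u; have [_ []] := HW u.
have [w [w_sym w13 w_neq]] := labelled_weighting (@adj_sym G) (@adj_irrefl G)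
  K0 q_large K_large p_eq d_large typ.
exact: weighting_of_matrix w_sym w13 w_neq.
Qed.
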